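(* Let $w\in S_n$, with rank matrix $r(w)$. (i) For every set $\mathcal{L}$ which is a union of classes of linked pillar entries of $r(w)$, there exists a permutation $w'\in S_n$ such that $r(w')$ is the admissible partial transposition of $r(w)$ associated with $\mathcal{L}$, that is, such that the pillar entries of $r(w')$ are exactly: the entries $r_{ij}(w')=r_{ij}(w)$ for all pillar entries $r_{ij}(w)\notin\mathcal{L}$, and the entries $r_{ji}(w')=r_{ij}(w)$ for all pillar entries $r_{ij}(w)\in\mathcal{L}$. (ii) If $w,w'\in S_n$ are admissibly partially transpose to each other, then the corresponding Schubert varieties have the same tangent cone: $\mathcal{T}_w=\mathcal{T}_{w'}$.
   Context: Flags and Schubert varieties. $\mathcal{F}$ is the variety of complete flags $\{0\}=V_0\subset V_1\subset\cdots\subset V_n=\mathbb{C}^n$, $\dim V_k=k$. Let $\varepsilon_1,\dots,\varepsilon_n$ be the standard basis, $\mathbb{C}^j=\langle\varepsilon_1,\dots,\varepsilon_j\rangle$, and let $F_0$ be the standard flag $V_k=\mathbb{C}^k$. $B\subset \mathrm{GL}(n,\mathbb{C})$ is the group of upper-triangular matrices. For $w\in S_n$, the Schubert cell $\mathcal{C}_w$ is the $B$-orbit of the flag with $V_k=\langle\varepsilon_{w(1)},\dots,\varepsilon_{w(k)}\rangle$, and the Schubert variety $\mathcal{X}_w$ is its closure; it always contains $F_0$. Tangent cone. Near $F_0$, flags are in bijection with lower unitriangular $n\times n$ matrices $X=(x_{ij})$ ($V_k$ is the span of the first $k$ columns), so the $x_{ij}$, $i>j$, are local coordinates centred at $F_0$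 and also coordinates on $T_{F_0}\mathcal{F}$. The tangent cone $\mathcal{T}_w\subset T_{F_0}\mathcal{F}$ of $\mathcal{X}_w$ at $F_0$ is the set of vectors tangent to $\mathcal{X}_w$ at $F_0$, i.e. the common zero set of the lowest-degree homogeneous parts of the polynomials in the $x_{ij}$ vanishing on $\mathcal{X}_w$ in this chart. Rank matrix and pillar entries. The rank matrix $r(w)=(r_{ij}(w))_{0\le i,j\le n}$ is given by $r_{ij}(w)=\dim(V_i\cap\mathbb{C}^j)$ for any flag in $\mathcal{C}_w$; equivalently $r_{ij}(w)=\#\{k\le i : w(k)\le j\}$. An entry $r_{ij}$ ($1\le i,j\le n-1$) is a pillar entry if $r_{ij}=r_{i-1,j}+1=r_{i,j-1}+1$ and $r_{ij}=r_{i+1,j}=r_{i,j+1}$. A pillar entry is understood as a position $(i,j)$ together with its value. Linked pillars. Two pillar entries $r_{ij}$ and $r_{i'j'}$ of $r(w)$ are related if the real intervals $[\min(i,j),\max(i,j)]$ and $[\min(i',j'),\max(i',j')]$ have a common interior point. Pillar entries are linked if they can be connected by a chain of related pillar entries; this partitions the set of pillar entries into classes of linked pillar entries (each pillar entry belonging to exactly one class). Admissible partial transposition. $r(w)$ and $r(w')$ (and also $w$ and $w'$) are admissibly partially transpose to each other if there is a set $\mathcal{L}$, a union of classes of linked pillar entries of $r(w)$, such that the set of pillar entries of $r(w')$ consists exactly of $r_{ij}(w')=r_{ij}(w)$ for the pillar entries $r_{ij}(w)\notin\mathcal{L}$, and $r_{ji}(w')=r_{ij}(w)$ for the pillar entries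 $r_{ij}(w)\in\mathcal{L}$. *)

(* Defs.v *)
From HB Require Import structures.
From mathcomp Require Import all_boot all_order all_fingroup all_algebra.
From mathcomp Require Import complex boolp reals.
From mathcomp Require Import mpoly.

Set Implicit Arguments.
Unset Strict Implicit.
Unset Printing Implicit Defensive.

Import Order.TTheory GRing.Theory Num.Theory.
Local Open Scope ring_scope.

(* Indices of basis vectors, matrix entries and permutations start at 0: the
   textbook epsilon_1, ..., epsilon_n are [std_basis 0], ..., [std_basis n.-1],
   and "the first k vectors" are those with index < k.  Dimensions k of the
   spaces of a flag and indices of the rank matrix run over 0, ..., n and are
   not shifted. *)

Section Flags.
Variables (K : fieldType) (n : nat).

Definition is_flag (V : {ffun 'I_n.+1 -> {vspace 'cV[K]_n}}) : bool :=
  [forall k, \dim (V k) == k]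
    && [forall i : 'I_n.+1, forall j : 'I_n.+1, (i <= j)%N ==> (V i <= V j)%VS].

Definition flag := {V : {ffun 'I_n.+1 -> {vspace 'cV[K]_n}} | is_flag V}.

Definition flag_space (V : flag) (k : 'I_n.+1) : {vspace 'cV[K]_n} := val V k.

Definition span_first (v : 'I_n -> 'cV[K]_n) (k : nat) : {vspace 'cV[K]_n} :=
  <<[seq v i | i : 'I_n <- enum 'I_n & (i < k)%N]>>%VS.

Definition std_basis (i : 'I_n) : 'cV[K]_n := delta_mx i 0.

Definition std_space (j : nat) : {vspace 'cV[K]_n} := span_first std_basis j.

Definition matrix_flag (g : 'M[K]_n) (V : flag) : Prop :=
  forall k, flag_space V k = span_first (fun i => col i g) k.

Definition upper_triangular (b : 'M[K]_n) : Prop :=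
  forall i j : 'I_n, (j < i)%N -> b i j = 0.

Definition schubert_cell (w : 'S_n) (V : flag) : Prop :=
  exists b : 'M[K]_n, [/\ b \in unitmx, upper_triangular b &
    forall k, flag_space V k
      = (linfun (mulmx b) @: span_first (fun i => std_basis (w i)) k)%VS].

(* The Zariski topology of the flag variety GL_n / B is the quotient topology:
   a set of flags is closed iff its preimage in GL_n is the zero locus in GL_n
   of a set of polynomials in the n * n matrix entries. *)
Definition zariski_closed (Z : flag -> Prop) : Prop :=
  exists S : {mpoly K[n * n]} -> Prop,
    forall (g : 'M[K]_n) (V : flag), g \in unitmx -> matrix_flag g V ->
      (Z V <-> forall p, S p -> p.@[mxvec g 0] = 0).

Definition schubert_variety (w : 'S_n) (V : flag) : Prop :=
  forall Z : flag -> Prop, zariski_closed Z ->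
    (forall U, schubert_cell w U -> Z U) -> Z V.

Definition lower_unitriangular (X : 'M[K]_n) : Prop :=
  forall i j : 'I_n, (i <= j)%N -> X i j = (i == j)%:R.

Definition lower_pos := {ij : 'I_n * 'I_n | (ij.2 < ij.1)%N}.

(* Polynomials in the x_ij, i > j: the variables are numbered through the
   enumeration of [lower_pos]. *)
Definition chart_poly := {mpoly K[#|{: lower_pos}|]}.

Definition chart_eval (p : chart_poly) (x : lower_pos -> K) : K :=
  p.@[fun k => x (enum_val k)].

Definition chart_coord (X : 'M[K]_n) (ij : lower_pos) : K :=
  X (val ij).1 (val ij).2.

Definition vanishes_on_schubert (w : 'S_n) (p : chart_poly) : Prop :=
  forall (X : 'M[K]_n) (V : flag), lower_unitriangular X -> matrix_flag X V ->
    schubert_variety w V -> chart_eval p (chart_coord X) = 0.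

Definition lowest_degree_part (p q : chart_poly) : Prop :=
  exists d : nat, [/\ q = pihomog mdeg d p, q != 0 &
    forall e, (e < d)%N -> pihomog mdeg e p = 0].

(* A tangent vector at the standard flag is given by its coordinates x_ij. *)
Definition tangent_cone (w : 'S_n) (v : lower_pos -> K) : Prop :=
  forall p q : chart_poly, vanishes_on_schubert w p ->
    lowest_degree_part p q -> chart_eval q v = 0.

End Flags.

Section Pillars.
Variables (R : realType) (n : nat).
Implicit Types (w : 'S_n) (p q : 'I_n * 'I_n) (L : {set 'I_n * 'I_n}).

Definition rank_entry w (i j : nat) : nat :=
  #|[set k : 'I_n | (k < i)%N & (w k < j)%N]|.

(* Membership of the positions in 'I_n gives i, j <= n.-1. *)
Definition is_pillar w p : bool :=
  let r := rank_entry w in let i : nat := p.1 in let j : nat := p.2 in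
  [&& (1 <= i)%N, (1 <= j)%N,
      r i j == (r i.-1 j + 1)%N, r i j == (r i j.-1 + 1)%N,
      r i j == r i.+1 j & r i j == r i j.+1].

Definition pillars w : {set 'I_n * 'I_n} := [set p | is_pillar w p].

(* The interior of the real interval [min(i, j), max(i, j)]; it is empty when
   i = j. *)
Definition pillar_interior p : interval R :=
  `](minn p.1 p.2)%:R, (maxn p.1 p.2)%:R[.

Definition related : rel ('I_n * 'I_n) := fun p q =>
  `[< exists x : R, x \in pillar_interior p /\ x \in pillar_interior q >].

Definition linked w : rel ('I_n * 'I_n) :=
  connect [rel p q | [&& p \in pillars w, q \in pillars w & related p q]].

Definition link_classes w : {set {set 'I_n * 'I_n}} :=
  equivalence_partition (linked w) (pillars w).

Definition union_of_link_classes w L : Prop :=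
  exists2 P : {set {set 'I_n * 'I_n}}, P \subset link_classes w & L = cover P.

Definition transpose_pos p : 'I_n * 'I_n := (p.2, p.1).

(* The pillar entries of w', as positions with values, are those of w outside
   L together with the transposes of those in L. *)
Definition partial_transposition L w w' : Prop :=
  [/\ pillars w' = (pillars w :\: L) :|: (transpose_pos @: L),
      forall p, p \in pillars w :\: L ->
        rank_entry w' p.1 p.2 = rank_entry w p.1 p.2 &
      forall p, p \in L -> rank_entry w' p.2 p.1 = rank_entry w p.1 p.2].

Definition admissibly_partially_transpose w w' : Prop :=
  exists2 L, union_of_link_classes w L & partial_transposition L w w'.

End Pillars.

(* [rank_entry], defined by counting, is also the dimension of the intersection
   of V_i with C^j for every flag V of the Schubert cell: [rank_entry_dim]. *)
Section RankDim.
Variables (K : fieldType) (n : nat).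

Lemma span_firstP (v : 'I_n -> 'cV[K]_n) k (U : {vspace 'cV[K]_n}) :
  reflect (forall i : 'I_n, (i < k)%N -> v i \in U) (span_first v k <= U)%VS.
Proof.
apply: (iffP span_subvP) => [h i ik | h _ /mapP[i + ->]].
  by apply: h; apply/mapP; exists i => //; rewrite mem_filter ik mem_enum.
by rewrite mem_filter => /andP[/h].
Qed.

Lemma span_coord0 (s : seq 'cV[K]_n) (i : 'I_n) (x : 'cV[K]_n) :
  (forall v, v \in s -> v i 0 = 0) -> x \in <<s>>%VS -> x i 0 = 0.
Proof.
move=> s0 xs; rewrite (coord_span (X := in_tuple s) xs) summxE big1 // => a _.
by rewrite mxE s0 ?mulr0 // mem_nth.
Qed.

Lemma std_decomp (w : 'S_n) (x : 'cV[K]_n) :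
  x = \sum_(i < n) x (w i) 0 *: std_basis K (w i).
Proof.
apply/colP => i; rewrite summxE (bigD1 ((w^-1)%g i)) //= big1.
  by rewrite !mxE permKV !eqxx mulr1 addr0.
move=> j ji; rewrite !mxE andbC /= -{1}(permKV w i) (inj_eq perm_inj).
by rewrite eq_sym (negPf ji) mulr0.
Qed.

Lemma mem_std_span (w : 'S_n) k (x : 'cV[K]_n) :
  (x \in span_first (fun i => std_basis K (w i)) k)
  = [forall i : 'I_n, (k <= i)%N ==> (x (w i) 0 == 0)].
Proof.
apply/idP/forallP => [xs i|h].
  apply/implyP => ki; apply/eqP; apply: span_coord0 xs => _ /mapP[j + ->].
  rewrite mem_filter => /andP[jk _]; rewrite mxE eqxx andbT (inj_eq perm_inj).
  by rewrite -val_eqE gtn_eqF //; exact: leq_trans jk ki.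
rewrite (std_decomp w x).
apply: memv_suml => i _; have [ki|ik] := leqP k i.
  by have /implyP/(_ ki)/eqP -> := h i; rewrite scale0r mem0v.
by apply: memvZ; move: i ik; apply/span_firstP.
Qed.

Lemma rank_entry_dim (w : 'S_n) (V : flag K n) (i : 'I_n.+1) (j : nat) :
  schubert_cell w V ->
  rank_entry w i j = \dim (flag_space V i :&: std_space K n j)%VS.
Proof.
case=> b [ub tb ->]; pose f : 'End('cV[K]_n) := linfun (mulmx b).
have fE x : f x = b *m x by rewrite lfunE.
have kf : lker f = 0%VS.
  apply/eqP; rewrite -subv0; apply/subvP => x; rewrite memv_ker fE memv0.
  by move=> /eqP bx; rewrite -[x](mulKmx ub) bx mulmx0.
have std1 : std_space K n j = span_first (fun i => std_basis K ((1%g : 'S_n) i)) j.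
  by rewrite /std_space /span_first; congr <<_>>%VS; apply: eq_map => a; rewrite perm1.
have fstd : (f @: std_space K n j)%VS = std_space K n j.
  apply/eqP; rewrite eqEdim limg_dim_eq ?kf ?capv0 // leqnn andbT.
  apply/subvP => _ /memv_imgP[x + ->]; rewrite std1 fE !mem_std_span.
  move=> /forallP h; apply/forallP => a; apply/implyP => ja; apply/eqP.
  rewrite perm1 mxE big1 // => c _; have [ca|ac] := ltnP c a.
    by rewrite tb // mul0r.
  have /implyP/(_ (leq_trans ja ac))/eqP := h c.
  by rewrite perm1 => ->; rewrite mulr0.
rewrite -{1}fstd -/f.
have -> : (f @: span_first (fun i => std_basis K (w i)) i :&: f @: std_space K n j
  = f @: (span_first (fun i => std_basis K (w i)) i :&: std_space K n j))%VS.
  apply/eqP; rewrite eqEsubv limg_cap andbT; apply/subvP => x; rewrite memv_cap.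
  case/andP=> /memv_imgP[y yV ->] /memv_imgP[z zS].
  move/lker0P: (introT eqP kf) => inj /inj yz.
  by rewrite memv_img // memv_cap yV yz zS.
rewrite limg_dim_eq ?kf ?capv0 //.
pose span_set (D : {set 'I_n}) := <<[seq std_basis K (w k) | k in D]>>%VS.
have mem_set D x :
    (x \in span_set D) = [forall k, (k \notin D) ==> (x (w k) 0 == 0)].
  apply/idP/forallP => [xs k|h].
    apply/implyP => kD; apply/eqP; apply: span_coord0 xs => _ /mapP[l + ->].
    rewrite mem_enum => lD; rewrite mxE eqxx andbT (inj_eq perm_inj).
    by case: eqP kD => [->|]; rewrite ?lD.
  rewrite (std_decomp w x).
  apply: memv_suml => k _; have [kD|kD] := boolP (k \in D).
    by apply/memvZ/memv_span/map_f; rewrite mem_enum.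
  by have /implyP/(_ kD)/eqP -> := h k; rewrite scale0r mem0v.
have dim_le D : (\dim (span_set D) <= #|D|)%N.
  by apply: leq_trans (dim_span _) _; rewrite size_map -cardE.
have dim_set D : \dim (span_set D) = #|D|.
  apply/eqP; rewrite eqn_leq dim_le /= -(leq_add2r #|~: D|) cardsC card_ord.
  apply: leq_trans (leq_add (leqnn _) (dim_le (~: D))).
  apply: leq_trans (dimv_add_leqif _ _).
  suff -> : (span_set D + span_set (~: D) = fullv)%VS.
    by rewrite dimvf /dim /= muln1.
  apply/eqP; rewrite eqEsubv subvf; apply/subvP => x _.
  rewrite (std_decomp w x); apply: memv_suml => k _; apply: memvZ.
  have [kD|kD] := boolP (k \in D).
    by apply: (subvP (addvSl _ _)); apply/memv_span/map_f; rewrite mem_enum.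
  apply: (subvP (addvSr _ _)); apply/memv_span/map_f.
  by rewrite mem_enum inE.
rewrite /rank_entry -dim_set; congr (\dim _); apply/vspaceP => x.
rewrite memv_cap std1 !mem_std_span mem_set.
apply/forallP/andP => [h|[/forallP h1 /forallP h2] k].
  split; apply/forallP => k; apply/implyP => lek.
    by have /implyP := h k; apply; rewrite inE negb_and -leqNgt lek.
  rewrite perm1; have /implyP := h ((w^-1)%g k); rewrite permKV; apply.
  by rewrite inE permKV negb_and -(leqNgt j) lek orbT.
apply/implyP; rewrite inE negb_and -!leqNgt => /orP[] lek.
  by have /implyP/(_ lek) := h1 k.
by have /implyP := h2 (w k); rewrite perm1; apply.
Qed.

End RankDim.

(* Main.v *)
Require Import Defs.
From mathcomp Require Import all_boot all_order all_fingroup all_algebra.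
From mathcomp Require Import complex boolp reals zify ring mpoly.

(** Membership in a Schubert variety is a system of rank conditions: if the
    columns of [X] span the flag [V], then [dim (V_i :&: C^j) >= r_ij] says that the
    block of the rows after [j] and the first [i] columns of [X] has rank at most
    [i - r_ij]. The conditions at the pillars imply the others
    ([pillars_dominate]), and together they describe the whole Schubert variety
    ([schubert_variety_rank], [rank_schubert_variety]): a flag that satisfies them
    lies in the Bruhat cell of a permutation which is reached from [w] by swaps,
    and each swap is a degeneration along a line of matrices.

    Both parts of the theorem reduce to one kind of step. Call [a] a cut if every
    pillar has both coordinates at most [a] or both at least [a]. Then the rank
    matrix is determined by its two quadrants at [(a, a)] on the diagonal
    ([cut_glue]). Gluing the first quadrant with the transpose of the second one
    gives a supermodular function with the boundary values of a rank matrix, hence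
    a rank matrix ([cut_flip]). This flip at [a] transposes exactly the pillars
    after [a]. The classes of linked pillars occupy disjoint intervals, so [L] and
    its complement are separated by cuts, and flips at these cuts transpose
    precisely the pillars in [L] ([flip_sequence]). This proves (i). The pillars
    determine the permutation, so it remains for (ii) to see that a flip at [a]
    preserves the tangent cone.

    At [a = 0] the flip is the passage from [w] to its inverse. It is realized by
    the inversion of unitriangular matrices, which transposes the rank conditions
    and changes the sign of tangent vectors. For general [a] only half of the
    matrix may be inverted. Take [X] and [Z] in the Schubert variety, with tangent
    vectors [v] and [- v], and splice them: let [Y] have the upper left block of
    [X], the lower right block of [Z^-1], and as its lower left block the product
    [(Z^-1)_21 Q X_21] with a constant matrix [Q]. The first columns of [Y] are a
    left multiple of those of [X], so [Y] inherits the conditions before the cut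
    from [X]; its last rows are a right multiple of those of [Z^-1], so it inherits
    the transposed conditions after the cut ([splice_in_schubert]). The first
    order terms of the diagonal blocks of [Y] are those of [v]. The lower left block is of second
    order, with leading term [v_21 Q v_21], and this equals [v_21] if [Q] is a
    generalized inverse of [v_21]. The surplus in the order of this block is
    undone by a torus that scales it and preserves the rank conditions. Hence [v]
    is tangent to the flipped variety ([cone_flip]); as flips are symmetric, this
    suffices.

    Tangent vectors are defined by lowest homogeneous parts and not by curves. The
    part of a curve with tangent [v] is played by linear combinations of
    evaluations at points of the variety, which exist by duality in spaces of
    polynomials ([cone_functional]); tensor products of such functionals give the
    tangent vectors of a product ([leading_cone]), as needed for the pair [X, Z]. *)

Set Implicit Arguments.
Unset Strict Implicit.
Unset Printing Implicit Defensive.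

(** * Rank matrices of permutations and their pillars *)

Section RankFunctions.
Variable n : nat.
Implicit Types (w u : 'S_n) (r s : nat -> nat -> nat).

Lemma rank_entryS w (k : 'I_n) j :
  rank_entry w k.+1 j = (rank_entry w k j + (w k < j))%N.
Proof.
rewrite /rank_entry [LHS](cardsD1 k) addnC inE ltnSn /=; congr (_ + _)%N.
apply: eq_card => l; rewrite !inE ltnS (leq_eqVlt l) -val_eqE /=.
by case: eqVneq => [->|] //=; rewrite ltnn.
Qed.

Lemma rank_entryV w i j : rank_entry (w^-1)%g i j = rank_entry w j i.
Proof.
rewrite /rank_entry -[LHS](card_imset _ (@perm_inj _ (w^-1)%g)).
apply: eq_card => k; rewrite !inE; apply/imsetP/andP => [[l]|[kj wki]].
  by rewrite inE => /andP[li wlj] ->; rewrite permKV.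
by exists (w k); rewrite ?inE permK ?wki.
Qed.

Lemma rank_entry0l w j : rank_entry w 0 j = 0.
Proof. by apply: eq_card0 => k; rewrite !inE. Qed.

Lemma rank_entry_overl w i j : n <= i -> rank_entry w i.+1 j = rank_entry w i j.
Proof.
move=> ni; apply: eq_card => k; rewrite !inE.
by rewrite !(leq_trans (ltn_ord k)) // ltnW.
Qed.

Lemma rank_entry_stepl w i j :
  rank_entry w i j <= rank_entry w i.+1 j <= (rank_entry w i j).+1.
Proof.
have [lin|ni] := ltnP i n; last by rewrite rank_entry_overl // leqnn leqnSn.
by rewrite (rank_entryS w (Ordinal lin)) /=; case: (_ < j); lia.
Qed.

Lemma rank_entry_stepr w i j :
  rank_entry w i j <= rank_entry w i j.+1 <= (rank_entry w i j).+1.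
Proof. by rewrite -!(rank_entryV w) rank_entry_stepl. Qed.

Lemma rank_entry_supermodular w i j :
  rank_entry w i.+1 j + rank_entry w i j.+1
    <= rank_entry w i j + rank_entry w i.+1 j.+1.
Proof.
have [lin|ni] := ltnP i n; last by rewrite !rank_entry_overl //; lia.
by rewrite !(rank_entryS w (Ordinal lin)) /=; lia.
Qed.

Lemma rank_entry_nr w i : i <= n -> rank_entry w i n = i.
Proof.
elim: i => [|i IH] lin; first exact: rank_entry0l.
by rewrite (rank_entryS w (Ordinal lin)) /= IH ?ltn_ord ?addn1 // ltnW.
Qed.

Definition unit_steps s :=
  forall i j, (s i j <= s i.+1 j <= (s i j).+1) /\ (s i j <= s i j.+1 <= (s i j).+1).

Lemma rank_entry_unit_steps w : unit_steps (rank_entry w).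
Proof. by move=> i j; split; [exact: rank_entry_stepl | exact: rank_entry_stepr]. Qed.

Lemma rank_entry_boundary w i : i <= n ->
  i <= rank_entry w i n /\ i <= rank_entry w n i.
Proof. by move=> lin; split; [|rewrite -rank_entryV]; rewrite rank_entry_nr. Qed.

(** Let [r] be the rank matrix and suppose that [s < r] at some position. Moving
    to a neighbour on the left or above with the same [r], or to a neighbour on
    the right or below with a larger [r], does not decrease [r - s], since [s] has
    unit steps; each such move increases [2 r - i - j] by one. So the moves come
    to an end, and a position from which no move starts is a pillar. *)
Lemma pillars_dominate w s : unit_steps s ->
  (forall i, i <= n -> i <= s i n /\ i <= s n i) ->
  (forall p, p \in pillars w -> rank_entry w p.1 p.2 <= s p.1 p.2) ->
  forall i j, i <= n -> j <= n -> rank_entry w i j <= s i j.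
Proof.
move=> ss sn sp i0 j0 in0 jn0; rewrite leqNgt; apply/negP => bad0.
(* truncated subtraction from [n] replaces [- i - j] *)
pose P (q : 'I_n.+1 * 'I_n.+1) := s q.1 q.2 < rank_entry w q.1 q.2.
pose F (q : 'I_n.+1 * 'I_n.+1) := 2 * rank_entry w q.1 q.2 + (n - q.1) + (n - q.2).
have P0 : P (inord i0, inord j0) by rewrite /P !inordK.
case: (arg_maxnP F P0) => -[[i lin] [j ljn]] /=; rewrite /P /F /= => bad mx.
have {}mx i' j' : i' <= n -> j' <= n -> s i' j' < rank_entry w i' j' ->
    2 * rank_entry w i' j' + (n - i') + (n - j')
      <= 2 * rank_entry w i j + (n - i) + (n - j).
  move=> li' lj' b; have := mx (inord i', inord j').
  by rewrite !inordK //; apply.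
have r0 k : rank_entry w k 0 = 0 by rewrite -rank_entryV rank_entry0l.
have rn k : k <= n -> rank_entry w n k = k.
  by move=> kn; rewrite -rank_entryV rank_entry_nr.
case: i lin bad mx => [|i] lin bad mx; first by rewrite rank_entry0l in bad.
case: j ljn bad mx => [|j] ljn bad mx; first by rewrite r0 in bad.
have in' : i.+1 < n.
  rewrite ltn_neqAle -ltnS lin andbT; apply/eqP => e.
  by have [_ h] := sn j.+1 ljn; rewrite e rn // in bad; lia.
have jn' : j.+1 < n.
  rewrite ltn_neqAle -ltnS ljn andbT; apply/eqP => e.
  by have [h _] := sn i.+1 lin; rewrite e rank_entry_nr // in bad; lia.
have := sp (Ordinal in', Ordinal jn'); rewrite inE /is_pillar /=.
have [r1 _] := rank_entry_unit_steps w i j.+1.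
have [_ r2] := rank_entry_unit_steps w i.+1 j.
have [r3 r4] := rank_entry_unit_steps w i.+1 j.+1.
have [s1 _] := ss i j.+1.
have [_ s2] := ss i.+1 j.
have [s3 s4] := ss i.+1 j.+1.
have := mx i j.+1; have := mx i.+1 j; have := mx i.+2 j.+1; have := mx i.+1 j.+2.
lia.
Qed.

(** A supermodular function with the boundary values of a rank matrix is a rank
    matrix: its increments in [i] go from 0 to 1 as [j] grows, and the place of
    the jump is the value of the permutation. *)
Lemma rank_function_perm r :
  (forall j, j <= n -> r 0 j = 0) -> (forall i, i <= n -> r i 0 = 0) ->
  (forall i, i <= n -> r i n = i) -> (forall j, j <= n -> r n j = j) ->
  (forall i j, i < n -> j < n -> r i.+1 j + r i j.+1 <= r i j + r i.+1 j.+1) ->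
  exists w : 'S_n, forall i j, i <= n -> j <= n -> rank_entry w i j = r i j.
Proof.
move=> r0j ri0 rin rnj sm.
have smr i j d : i < n -> j + d <= n -> r i.+1 j + r i (j + d) <= r i j + r i.+1 (j + d).
  move=> lin; elim: d => [|d IH]; rewrite ?addn0 ?addnS // => h.
    by rewrite addnC.
  by have := sm i (j + d) lin h; have := IH (ltnW h); lia.
have sml i j d : j < n -> i + d <= n -> r (i + d) j + r i j.+1 <= r i j + r (i + d) j.+1.
  move=> lin; elim: d => [|d IH]; rewrite ?addn0 ?addnS // => h.
  by have := sm (i + d) j h lin; have := IH (ltnW h); lia.
have ex i : i < n -> exists j, (j < n) && (r i j.+1 < r i.+1 j.+1).
  move=> lin; exists n.-1; have n0 : 0 < n by lia.
  by rewrite prednK // leqnn rin ?rin //; lia.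
have /fin_all_exists[f fP] : forall i : 'I_n, exists c : 'I_n,
    forall j, j <= n -> r i.+1 j = r i j + (c < j).
  move=> i; case: (ex_minnP (ex i (ltn_ord i))) => c /andP[cn rc] cmin.
  exists (Ordinal cn) => j jn /=.
  have := smr i 0 j (ltn_ord i) jn; have := smr i j (n - j) (ltn_ord i).
  rewrite (subnKC jn) (rin _ (ltn_ord i)) (rin _ (ltnW (ltn_ord i))) add0n.
  rewrite (ri0 _ (ltn_ord i)) (ri0 _ (ltnW (ltn_ord i))) => /(_ (leqnn n)) h1 h2.
  have [cj|jc] := ltnP c j.
    by have := smr i c.+1 (j - c.+1) (ltn_ord i); rewrite subnKC // => /(_ jn); lia.
  case: j jn jc h1 h2 => [|j] jn jc h1 h2.
    by rewrite (ri0 _ (ltn_ord i)) (ri0 _ (ltnW (ltn_ord i))).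
  have := cmin j; rewrite jn /=; case: ltnP; last by lia.
  by move=> _ /(_ isT); lia.
have f_inj : injective f.
  have lt (i i' : 'I_n) : i < i' -> f i = f i' -> False.
    move=> ii' e; have cn := ltn_ord (f i).
    have := fP i _ cn; have := fP i _ (ltnW cn).
    have := fP i' _ cn; have := fP i' _ (ltnW cn).
    rewrite -e ltnn ltnSn.
    have := sml 0 (f i) i cn (ltnW (ltn_ord i)).
    have := sml i.+1 (f i) (i' - i.+1) cn.
    have := sml i'.+1 (f i) (n - i'.+1) cn.
    rewrite (subnKC (ltn_ord i')) (subnKC ii') add0n.
    rewrite !(rnj _ cn) !(rnj _ (ltnW cn)) !(r0j _ cn) !(r0j _ (ltnW cn)).
    by move=> /(_ (leqnn n)) ? /(_ (ltnW (ltn_ord i'))); lia.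
  move=> i i' e; apply/val_inj; case: (ltngtP i i') => // h.
    by case: (lt _ _ h e).
  by case: (lt _ _ h (esym e)).
exists (perm f_inj) => i j; elim: i => [|i IH] lin jn.
  by rewrite rank_entry0l r0j.
rewrite (rank_entryS _ (Ordinal lin)) permE IH ?(ltnW lin) //.
by rewrite [RHS](fP (Ordinal lin) j jn).
Qed.

End RankFunctions.

(** * Gluing rank matrices along a cut *)

Section Glue.
Implicit Types r s : nat -> nat -> nat.

Lemma unit_stepsl s i i' j : unit_steps s -> i <= i' ->
  s i j <= s i' j <= s i j + (i' - i).
Proof.
move=> ss /subnKC <-; rewrite addKn; elim: (i' - i) => [|d]; first by rewrite !addn0 leqnn.
rewrite addnS.
by have [+ _] := ss (i + d) j; lia.
Qed.

Lemma unit_stepsr s i j j' : unit_steps s -> j <= j' ->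
  s i j <= s i j' <= s i j + (j' - j).
Proof.
move=> ss /subnKC <-; rewrite addKn; elim: (j' - j) => [|d]; first by rewrite !addn0 leqnn.
rewrite addnS.
by have [_ +] := ss i (j + d); lia.
Qed.

(** The quadrants of [glue a r1 r2] before and after [(a, a)] come from [r1] and
    [r2]; on the two other quadrants it is the smallest function with unit steps
    that agrees with them on the borders. Permutations realize this minimum when they decrease on
    both of these quadrants. *)
Definition glue a r1 r2 i j :=
  if i <= a then
    if j <= a then r1 i j else maxn (r1 i a) (i + r2 a j - a)
  else
    if j <= a then maxn (r1 a j) (j + r2 i a - a) else r2 i j.

Lemma glue_ll a r1 r2 i j : i <= a -> j <= a -> glue a r1 r2 i j = r1 i j.
Proof. by rewrite /glue => -> ->. Qed.

Lemma glue_lr a r1 r2 i j : unit_steps r1 -> r1 a a = r2 a a -> i <= a -> a <= j ->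
  glue a r1 r2 i j = maxn (r1 i a) (i + r2 a j - a).
Proof.
move=> s1 e ia aj; rewrite /glue ia; case: leqP => // ja.
have -> : j = a by lia.
by have := unit_stepsl a s1 ia; lia.
Qed.

Lemma glue_rl a r1 r2 i j : unit_steps r1 -> r1 a a = r2 a a -> a <= i -> j <= a ->
  glue a r1 r2 i j = maxn (r1 a j) (j + r2 i a - a).
Proof.
move=> s1 e ai ja; rewrite /glue ja; case: leqP => // ia.
have -> : i = a by lia.
by have := unit_stepsr a s1 ja; lia.
Qed.

Lemma glue_rr a r1 r2 i j : unit_steps r1 -> unit_steps r2 -> r1 a a = r2 a a ->
  a <= i -> a <= j -> glue a r1 r2 i j = r2 i j.
Proof.
move=> s1 s2 e ai aj; have [ia|ai'] := leqP i a; have [ja|aj'] := leqP j a.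
- by have [-> ->] : i = a /\ j = a; [lia | rewrite glue_ll].
- rewrite glue_lr //; have -> : i = a by lia.
  by have := unit_stepsr a s2 aj; lia.
- rewrite glue_rl //; have -> : j = a by lia.
  by have := unit_stepsl a s2 ai; lia.
- by rewrite /glue (leqNgt i) ai' (leqNgt j) aj'.
Qed.

Lemma unit_steps_glue a r1 r2 : unit_steps r1 -> unit_steps r2 ->
  r1 a a = r2 a a -> unit_steps (glue a r1 r2).
Proof.
move=> s1 s2 e i j.
have [ia|ai] := leqP i.+1 a; have [ja|aj] := leqP j.+1 a.
- rewrite !glue_ll ?(ltnW ia) ?(ltnW ja) //; exact: s1.
- rewrite !glue_lr ?(ltnW ia) ?(ltnW aj) //.
  by have [+ _] := s1 i a; have [_ +] := s2 a j; lia.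
- rewrite !glue_rl ?(ltnW ja) ?(ltnW ai) //.
  by have [_ +] := s1 a j; have [+ _] := s2 i a; lia.
- rewrite !glue_rr ?(ltnW ai) ?(ltnW aj) //; exact: s2.
Qed.

(** On the quadrant [i <= a <= j] the function is [i - min(f i, g j)] with [f]
    nondecreasing and [g] nonincreasing, both by steps of at most one, and such a
    function is supermodular; the other mixed quadrant is symmetric. *)
Lemma supermodular_glue a r1 r2 i j : unit_steps r1 -> unit_steps r2 ->
  r1 a a = r2 a a ->
  (forall r, r = r1 \/ r = r2 -> forall i j, r i.+1 j + r i j.+1 <= r i j + r i.+1 j.+1) ->
  glue a r1 r2 i.+1 j + glue a r1 r2 i j.+1
    <= glue a r1 r2 i j + glue a r1 r2 i.+1 j.+1.
Proof.
move=> s1 s2 e sm.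
have [ia|ai] := leqP i.+1 a; have [ja|aj] := leqP j.+1 a.
- rewrite !glue_ll ?(ltnW ia) ?(ltnW ja) //; apply: sm; tauto.
- rewrite !glue_lr ?(ltnW ia) ?(ltnW aj) //.
  by have [+ _] := s1 i a; have [_ +] := s2 a j; lia.
- rewrite !glue_rl ?(ltnW ja) ?(ltnW ai) //.
  by have [_ +] := s1 a j; have [+ _] := s2 i a; lia.
- rewrite !glue_rr ?(ltnW ai) ?(ltnW aj) //; apply: sm; tauto.
Qed.

End Glue.

Section Cut.
Variable n : nat.
Implicit Types (w u : 'S_n) (r s : nat -> nat -> nat).

Definition cut a w := forall p, p \in pillars w ->
  ((p.1 <= a) && (p.2 <= a)) || ((a <= p.1) && (a <= p.2)).

(** Both functions agree at all pillars, since none of them lies in a mixed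
    quadrant, and pillars determine a rank matrix; the other inequality is the
    minimality of [glue]. *)
Lemma cut_glue a w : a <= n -> cut a w -> forall i j, i <= n -> j <= n ->
  rank_entry w i j = glue a (rank_entry w) (rank_entry w) i j.
Proof.
move=> an cw i j lin ljn; have sw := rank_entry_unit_steps w.
have rn k : k <= n -> rank_entry w n k = k.
  by move=> kn; rewrite -rank_entryV rank_entry_nr.
apply/eqP; rewrite eqn_leq; apply/andP; split.
  apply: pillars_dominate => //; first exact: unit_steps_glue.
    move=> k kn; have [ka|ak] := leqP k a.
      by rewrite glue_lr // glue_rl // !(rn, rank_entry_nr) //; lia.
    by rewrite !glue_rr ?(rn, rank_entry_nr) //; lia.
  move=> p /cw/orP[] /andP[h1 h2]; first by rewrite glue_ll.
  by rewrite glue_rr.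
have [ia|ai] := leqP i a; have [ja|aj] := leqP j a.
- by rewrite glue_ll.
- have := unit_stepsl j sw ia; have := unit_stepsr i sw (ltnW aj).
  by rewrite glue_lr ?(ltnW aj) //; lia.
- have := unit_stepsr i sw ja; have := unit_stepsl j sw (ltnW ai).
  by rewrite glue_rl ?(ltnW ai) //; lia.
- by rewrite glue_rr // ltnW.
Qed.

Definition flip a w w' := [/\ cut a w, cut a w',
  forall i j, i <= a -> j <= a -> rank_entry w' i j = rank_entry w i j &
  forall i j, a <= i <= n -> a <= j <= n -> rank_entry w' i j = rank_entry w j i].

Lemma flip_sym a w w' : flip a w w' -> flip a w' w.
Proof. by case=> c c' h1 h2; split=> // i j ai aj; [rewrite h1 | rewrite h2]. Qed.

(** The gluing of the rank matrices of [w] and of its inverse is supermodular and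
    has the boundary values of a rank matrix. A pillar in a mixed quadrant would
    need [f i < g j] and [g j < f i] for the two functions whose minimum describes
    the gluing there, so [a] remains a cut. *)
Lemma cut_flip a w : a <= n -> cut a w -> exists w', flip a w w'.
Proof.
move=> an cw; have sw := rank_entry_unit_steps w.
have sv := rank_entry_unit_steps (w^-1)%g.
pose g := glue a (rank_entry w) (rank_entry (w^-1)%g).
have e : rank_entry w a a = rank_entry (w^-1)%g a a by rewrite rank_entryV.
have rn (u : 'S_n) k : k <= n -> rank_entry u n k = k.
  by move=> kn; rewrite -rank_entryV rank_entry_nr.
have r0 (u : 'S_n) k : rank_entry u k 0 = 0.
  by rewrite -rank_entryV rank_entry0l.
have [||||i j lin ljn|w' w'g] := @rank_function_perm n g.
- move=> j jn; rewrite /g; have [ja|aj] := leqP j a.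
    by rewrite glue_ll ?rank_entry0l.
  have := unit_stepsl j sv (leq0n a); rewrite glue_lr ?(ltnW aj) //.
  have := unit_stepsr a sv (ltnW aj).
  have := unit_stepsr a sv jn.
  rewrite !rank_entry0l rank_entry_nr //; lia.
- move=> j jn; rewrite /g; have [ja|aj] := leqP j a.
    by rewrite glue_ll ?r0.
  have := unit_stepsr j sv (leq0n a); rewrite glue_rl ?(ltnW aj) //.
  rewrite !r0; lia.
- move=> j jn; rewrite /g; have [ja|aj] := leqP j a.
    have := unit_stepsl a sw (leq0n j).
    by rewrite glue_lr // rank_entry0l rank_entry_nr //; lia.
  by rewrite glue_rr ?rank_entry_nr // ltnW.
- move=> j jn; rewrite /g; have [ja|aj] := leqP j a.
    have := unit_stepsr a sw (leq0n j).
    by rewrite glue_rl // r0 rn //; lia.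
  by rewrite glue_rr ?rn // ltnW.
- by apply: supermodular_glue => // r [] ->; exact: rank_entry_supermodular.
exists w'; split=> //.
- have Elr k l : k <= a -> a <= l <= n ->
      rank_entry w' k l = maxn (rank_entry w k a) (k + rank_entry (w^-1)%g a l - a).
    move=> ka /andP[al ln].
    by rewrite w'g ?(leq_trans ka) // /g glue_lr.
  have Erl k l : a <= k <= n -> l <= a ->
      rank_entry w' k l = maxn (rank_entry w a l) (l + rank_entry (w^-1)%g k a - a).
    move=> /andP[ak kn] la.
    by rewrite w'g ?(leq_trans la) // /g glue_rl.
  case=> -[i lin] [j ljn]; rewrite inE /is_pillar /=.
  have [ia|ai] := leqP i a; have [ja|aj] := leqP j a => //=; last by lia.
    rewrite (ltnW aj) andbT => /and5P[_ _ _ h2 /andP[h3 _]].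
    have [i1|->] : i < a \/ i = a by lia.
      have [+ _] := sw i a; have [_ +] := sv a j.-1; rewrite prednK; last by lia.
      by move: h2 h3; rewrite (Elr i j) ?(Elr i.+1 j) ?(Elr i j.-1); lia.
    exact: leqnn.
  rewrite (ltnW ai) /= => /and5P[_ _ h2 _ /andP[_ h3]].
  have [j1|->] : j < a \/ j = a by lia.
    have [_ +] := sw a j; have [+ _] := sv i.-1 a; rewrite prednK; last by lia.
    by move: h2 h3; rewrite (Erl i j) ?(Erl i j.+1) ?(Erl i.-1 j); lia.
  exact: leqnn.
- by move=> i j ia ja; rewrite w'g ?(leq_trans _ an) // /g glue_ll.
- move=> i j /andP[ai lin] /andP[aj ljn].
  by rewrite w'g // /g glue_rr // rank_entryV.
Qed.

Lemma cut_lr a w i j : a <= n -> cut a w -> i <= a -> a <= j <= n ->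
  rank_entry w i j = maxn (rank_entry w i a) (i + rank_entry w a j - a).
Proof.
move=> an cw ia /andP[aj jn]; have sw := rank_entry_unit_steps w.
by rewrite {1}(cut_glue an cw) ?glue_lr ?(leq_trans ia).
Qed.

Lemma cut_rl a w i j : a <= n -> cut a w -> a <= i <= n -> j <= a ->
  rank_entry w i j = maxn (rank_entry w a j) (j + rank_entry w i a - a).
Proof.
move=> an cw /andP[ai lin] ja; have sw := rank_entry_unit_steps w.
by rewrite {1}(cut_glue an cw) ?glue_rl ?(leq_trans ja).
Qed.

(** Whether a position is a pillar depends on the rank matrix at its four
    neighbours, and for a position on the border of a quadrant some of them lie in
    a mixed quadrant. There [cut_lr] and [cut_rl] decide the comparison in the same
    way for both permutations. *)
Lemma flip_pillar a w w' p : a <= n -> flip a w w' -> p \in pillars w ->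
  p.1 <= a -> p.2 <= a -> p \in pillars w'.
Proof.
move=> an [cw cw' wl wr]; case: p => -[i lin] [j ljn]; rewrite !inE /is_pillar /=.
have sw := rank_entry_unit_steps w; have sw' := rank_entry_unit_steps w'.
move=> /and5P[i0 j0 h1 h2 /andP[h3 h4]] ia ja.
have [laa _] := sw a a; have [_ raa] := sw a a.
have [laa' _] := sw' a a; have [_ raa'] := sw' a a.
have E := wl a a (leqnn a) (leqnn a).
rewrite i0 j0 /= (wl i j) // (wl i.-1 j) ?(wl i j.-1) ?h1 ?h2 /=; try lia.
apply/andP; split.
  have [i1|ei] : i < a \/ i = a by lia.
    by rewrite wl.
  rewrite {}ei in h1 h2 h3 h4 lin *.
  have e1 : rank_entry w' a.+1 j = maxn (rank_entry w a j) (j + rank_entry w' a.+1 a - a).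
    by rewrite (cut_rl an cw') ?leqnSn // (wl a j).
  have e2 : rank_entry w a.+1 j = maxn (rank_entry w a j) (j + rank_entry w a.+1 a - a).
    by rewrite {1}(cut_rl an cw) ?leqnSn.
  have [j1|ej] : j < a \/ j = a by lia.
    by have := unit_stepsr a sw j1; lia.
  rewrite {}ej in h1 h2 h3 h4 e1 e2 ljn *.
  by have := wr a.+1 a; rewrite leqnSn an lin leqnn => /(_ isT isT); lia.
have [j1|ej] : j < a \/ j = a by lia.
  by rewrite wl.
rewrite {}ej in h1 h2 h3 h4 ljn *.
have e1 : rank_entry w' i a.+1 = maxn (rank_entry w i a) (i + rank_entry w' a a.+1 - a).
  by rewrite (cut_lr an cw') ?leqnSn // (wl i a).
have e2 : rank_entry w i a.+1 = maxn (rank_entry w i a) (i + rank_entry w a a.+1 - a).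
  by rewrite {1}(cut_lr an cw) ?leqnSn.
have [i1|ei] : i < a \/ i = a by lia.
  by have := unit_stepsl a sw i1; lia.
rewrite {}ei in h1 h2 h3 h4 e1 e2 lin *.
by have := wr a a.+1; rewrite leqnSn an ljn leqnn => /(_ isT isT); lia.
Qed.
End Cut.

Section FlipPillars.
Variable n : nat.
Implicit Types (w u : 'S_n) (p q : 'I_n * 'I_n).

Lemma flip_pillar_transpose a w w' p : a <= n -> flip a w w' -> p \in pillars w ->
  a <= p.1 -> a <= p.2 -> transpose_pos p \in pillars w'.
Proof.
move=> an [cw cw' wl wr]; case: p => -[i lin] [j ljn]; rewrite !inE /is_pillar /=.
move=> /and5P[i0 j0 h1 h2 /andP[h3 h4]] ai aj.
rewrite i0 j0 /= (wr j i) ?(wr j.+1 i) ?(wr j i.+1); try lia.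
rewrite h3 h4 !andbT; apply/andP; split.
  have [j1|ej] : a <= j.-1 \/ j = a by lia.
    by rewrite wr //; lia.
  rewrite {}ej in h1 h2 h3 h4 ljn j0 aj *.
  have e : rank_entry w' a.-1 i = maxn (rank_entry w' a.-1 a) (a.-1 + rank_entry w' a i - a).
    by rewrite {1}(cut_lr an cw') //; lia.
  have e1 : rank_entry w i a.-1 = maxn (rank_entry w a a.-1) (a.-1 + rank_entry w i a - a).
    by rewrite {1}(cut_rl an cw) //; lia.
  have e2 : rank_entry w' a i = rank_entry w i a by rewrite wr //; lia.
  have e3 : rank_entry w' a.-1 a = rank_entry w a.-1 a by rewrite wl //; lia.
  have [i1|ei] : a <= i.-1 \/ i = a by lia.
    have := unit_stepsl a (rank_entry_unit_steps w) i1.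
    have := unit_stepsl a (rank_entry_unit_steps w) (leq_pred a).
    by lia.
  by rewrite {}ei in h1 h2 h3 h4 lin i0 ai e e1 e2 e3 *; lia.
have [i1|ei] : a <= i.-1 \/ i = a by lia.
  by rewrite wr //; lia.
rewrite {}ei in h1 h2 h3 h4 lin i0 ai *.
have e : rank_entry w' j a.-1 = maxn (rank_entry w' a a.-1) (a.-1 + rank_entry w' j a - a).
  by rewrite {1}(cut_rl an cw') //; lia.
have e1 : rank_entry w a.-1 j = maxn (rank_entry w a.-1 a) (a.-1 + rank_entry w a j - a).
  by rewrite {1}(cut_lr an cw) //; lia.
have e2 : rank_entry w' j a = rank_entry w a j by rewrite wr //; lia.
have e3 : rank_entry w' a a.-1 = rank_entry w a a.-1 by rewrite wl //; lia.
have [j1|ej] : a <= j.-1 \/ j = a by lia.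
  have := unit_stepsr a (rank_entry_unit_steps w) j1.
  have := unit_stepsr a (rank_entry_unit_steps w) (leq_pred a).
  by lia.
by rewrite {}ej in h1 h2 h3 h4 ljn j0 aj e e1 e2 e3 *; lia.
Qed.

Definition flip_pos a p := if a <= minn p.1 p.2 then transpose_pos p else p.

Lemma transpose_posK : involutive (@transpose_pos n).
Proof. by case. Qed.

Lemma flip_posK a : involutive (flip_pos a).
Proof.
by move=> p; rewrite /flip_pos; case h: (a <= minn p.1 p.2); rewrite /= ?(minnC p.2) h ?transpose_posK.
Qed.

Lemma flip_pos_pillar a w w' p : a <= n -> flip a w w' -> p \in pillars w ->
  flip_pos a p \in pillars w' /\
  rank_entry w' (flip_pos a p).1 (flip_pos a p).2 = rank_entry w p.1 p.2.
Proof.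
move=> an f pw; rewrite /flip_pos; case: ifP; rewrite leq_min => h.
  have /andP[h1 h2] := h; split; first exact: flip_pillar_transpose f pw _ _.
  by case: f => _ _ _ ->; rewrite ?h1 ?h2 /= ?(ltnW (ltn_ord _)).
case: (f) => cw _ wl _; have := cw p pw; rewrite h orbF => /andP[h1 h2].
by split; [exact: flip_pillar f pw _ _ | rewrite wl].
Qed.

Lemma pillars_flip a w w' : a <= n -> flip a w w' ->
  pillars w' = [set flip_pos a p | p in pillars w].
Proof.
move=> an f; apply/setP => p; apply/idP/imsetP => [pw|[q qw ->]].
  exists (flip_pos a p); last by rewrite flip_posK.
  exact: (flip_pos_pillar an (flip_sym f) pw).1.
exact: (flip_pos_pillar an f qw).1.
Qed.

End FlipPillars.

(** * Unions of link classes and sequences of cuts *)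

Section LinkClasses.
Variables (R : realType) (n : nat).
Implicit Types (w u : 'S_n) (p q : 'I_n * 'I_n) (L : {set 'I_n * 'I_n}).

(** The unit interval from [m] to [m + 1] lies in the interval of [p]. *)
Definition covers m p := minn p.1 p.2 <= m < maxn p.1 p.2.

Lemma covers_transpose m p : covers m (transpose_pos p) = covers m p.
Proof. by rewrite /covers /= minnC maxnC. Qed.

Import Order.TTheory GRing.Theory Num.Theory.

Lemma covers_related m p q : covers m p -> covers m q -> related R p q.
Proof.
move=> /andP[p1 p2] /andP[q1 q2]; apply/asboolP.
exists ((m%:R + 2^-1)%R : R).
have lo k : k <= m -> ((k%:R : R) < m%:R + 2^-1)%R.
  by rewrite -(ler_nat R) => h; apply: (le_lt_trans h); rewrite ltrDl invr_gt0 ltr0n.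
have hi k : m < k -> (m%:R + 2^-1 < (k%:R : R))%R.
  rewrite -(ler_nat R) -natr1 => h; apply: lt_le_trans h.
  by rewrite ltrD2l invf_lt1 ?ltr1n ?ltr0n.
by rewrite !in_itv /= !lo ?hi.
Qed.

Section Union.
Variables (w : 'S_n) (L : {set 'I_n * 'I_n}).
Hypothesis unionL : union_of_link_classes R w L.

Lemma link_union_pillars : L \subset pillars w.
Proof.
case: unionL => P /subsetP PC ->; apply/bigcupsP => B /PC /imsetP[x _ ->].
by apply/subsetP => p; rewrite inE => /andP[].
Qed.

Lemma link_union_closed m p q : p \in pillars w -> q \in L ->
  covers m p -> covers m q -> p \in L.
Proof.
move=> pw qL mp mq; have qw := subsetP link_union_pillars _ qL.
move: qL; case: unionL => P /subsetP PC -> /bigcupP[B BP qB].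
apply/bigcupP; exists B => //; move: qB; have /imsetP[x xw ->] := PC _ BP.
rewrite !inE => /andP[_ xq]; rewrite inE in pw; rewrite pw /=.
apply: connect_trans xq (connect1 _) => /=.
by rewrite qw inE pw (covers_related mq mp).
Qed.

Definition covered m := [exists q in L, covers m q].

(** Shifted by one, so that processing the cut [a] compares [bit a] with
    [bit a.+1]; before the first cut nothing is transposed. *)
Definition bit m := if m is m'.+1 then covered m' else false.

Lemma covered_pillar m p : p \in pillars w -> covers m p -> covered m = (p \in L).
Proof.
move=> pw mp; apply/existsP/idP => [[q /andP[qL mq]]|pL].
  exact: link_union_closed mp mq.
by exists p; rewrite pL.
Qed.

(** An interval with [k] in its interior covers the unit intervals on both sides
    of [k], so the bits on both sides tell whether its pillar belongs to [L]. *)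
Lemma bit_cut k p : bit k.+1 != bit k -> p \in pillars w ->
  ~~ ((minn p.1 p.2 < k) && (k < maxn p.1 p.2)).
Proof.
case: k => [|k] /= h pw; first by [].
apply/negP => /andP[h1 h2]; move/eqP: h; apply.
by rewrite !(covered_pillar pw) // /covers; lia.
Qed.

(** The position of [p] after the cuts smaller than [k] have been processed. *)
Definition upto k p := if bit (minn k (minn p.1 p.2).+1) then transpose_pos p else p.

Lemma minn_upto k p : minn (upto k p).1 (upto k p).2 = minn p.1 p.2.
Proof. by rewrite /upto; case: ifP => //= _; rewrite minnC. Qed.

Lemma maxn_upto k p : maxn (upto k p).1 (upto k p).2 = maxn p.1 p.2.
Proof. by rewrite /upto; case: ifP => //= _; rewrite maxnC. Qed.

Lemma upto_step k p : bit k.+1 != bit k -> p \in pillars w ->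
  upto k.+1 p = flip_pos k (upto k p).
Proof.
move=> h pw; rewrite /flip_pos minn_upto /upto; set m := minn p.1 p.2.
have [km|mk] := boolP (k <= m).
  have [-> ->] : minn k.+1 m.+1 = k.+1 /\ minn k m.+1 = k by lia.
  by move: h; case: (bit k.+1); case: (bit k) => //=; rewrite transpose_posK.
by have [-> ->] : minn k.+1 m.+1 = m.+1 /\ minn k m.+1 = m.+1 by lia.
Qed.

Lemma upto_stay k p : bit k.+1 = bit k -> upto k.+1 p = upto k p.
Proof.
move=> h; rewrite /upto; set m := minn p.1 p.2; have [km|mk] := boolP (k <= m).
  by have [-> ->] : minn k.+1 m.+1 = k.+1 /\ minn k m.+1 = k; [lia|rewrite h].
by have [-> ->] : minn k.+1 m.+1 = m.+1 /\ minn k m.+1 = m.+1 by lia.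
Qed.

Lemma upto_end p : p \in pillars w -> upto n p = if p \in L then transpose_pos p else p.
Proof.
move=> pw; rewrite /upto (minn_idPr _); last by rewrite gtn_min ltn_ord.
have [e|ne] := eqVneq p.1 p.2.
  have -> : transpose_pos p = p by case: p e {pw} => i j /= ->.
  by rewrite !if_same.
rewrite /= (covered_pillar pw) // /covers leqnn /=.
by move: ne; rewrite -val_eqE /=; lia.
Qed.

(** Flipping at every cut where the bit changes, from left to right, transposes
    each pillar as many times as there are such cuts before it, which is an odd
    number for the pillars in [L] and an even number for the others (pillars on
    the diagonal do not move). Any equivalence that holds along flips then holds
    between [w] and the result. *)
Lemma flip_sequence (Q : 'S_n -> 'S_n -> Prop) :
  (forall u, Q u u) ->
  (forall u v t, Q u v -> Q v t -> Q u t) ->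
  (forall a u v, a <= n -> flip a u v -> Q u v) ->
  exists2 w', partial_transposition L w w' & Q w w'.
Proof.
move=> Qrefl Qtrans Qflip.
suff : forall k, k <= n -> exists u, [/\ Q w u, pillars u = [set upto k p | p in pillars w] &
    forall p, p \in pillars w ->
      rank_entry u (upto k p).1 (upto k p).2 = rank_entry w p.1 p.2].
  move=> /(_ n (leqnn n))[u [Qu pu ru]]; exists u => //; split.
  - apply/setP => p; rewrite pu; apply/imsetP/setUP => [[q qw ->]|[]].
    + rewrite upto_end //; case: ifP => qL; first by right; apply: imset_f.
      by left; rewrite inE qL.
    + by rewrite inE => /andP[pL pw]; exists p => //; rewrite upto_end // (negPf pL).
    + move=> /imsetP[q qL ->]; have qw := subsetP link_union_pillars _ qL.
      by exists q => //; rewrite upto_end // qL.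
  - move=> p; rewrite inE => /andP[pL pw].
    by have := ru p pw; rewrite upto_end // (negPf pL).
  - move=> p pL; have pw := subsetP link_union_pillars _ pL.
    by have := ru p pw; rewrite upto_end // pL.
elim=> [|k IH] kn.
  have u0 p : upto 0 p = p by rewrite /upto min0n.
  exists w; split=> [||p _]; [by []| |by rewrite u0].
  by rewrite -[LHS]imset_id; apply: eq_imset => p; rewrite u0.
have [u [Qu pu ru]] := IH (ltnW kn).
have [h|h] := eqVneq (bit k.+1) (bit k).
  exists u; split=> [||p pw]; [by []| |by rewrite upto_stay ?ru].
  by rewrite pu; apply: eq_imset => p; rewrite upto_stay.
have cu : cut k u.
  move=> p; rewrite pu => /imsetP[q qw ->]; have := bit_cut h qw.
  by rewrite -(minn_upto k q) -(maxn_upto k q); case: (upto k q) => i j /=; clear; lia.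
have [u' f] := cut_flip (ltnW kn) cu; exists u'; split.
- by apply: Qtrans Qu (Qflip _ _ _ (ltnW kn) f).
- rewrite (pillars_flip (ltnW kn) f) pu -imset_comp.
  by apply: eq_in_imset => p pw /=; rewrite upto_step.
- move=> p pw; rewrite upto_step //.
  have /(flip_pos_pillar (ltnW kn) f)[_ ->] : upto k p \in pillars u.
    by rewrite pu imset_f.
  exact: ru.
Qed.

End Union.
End LinkClasses.

Lemma rank_entry_inj n (u w : 'S_n) :
  (forall i j, i <= n -> j <= n -> rank_entry u i j = rank_entry w i j) -> u = w.
Proof.
move=> e; apply/permP => k; apply/val_inj.
have lt j : j <= n -> (u k < j) = (w k < j).
  move=> jn; have := e k.+1 j (ltn_ord k) jn; rewrite !rank_entryS (e k j) ?(ltnW (ltn_ord k)) //.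
  by move/addnI; case: (_ < j); case: (_ < j).
have := lt _ (ltn_ord (u k)); have := lt _ (ltn_ord (w k)).
by rewrite /= !ltnSn; lia.
Qed.

(** The pillars with their values determine the rank matrix. *)
Lemma partial_transposition_unique n L (w u u' : 'S_n) :
  partial_transposition L w u -> partial_transposition L w u' -> u = u'.
Proof.
have dom (x y : 'S_n) : partial_transposition L w x -> partial_transposition L w y ->
    forall i j, i <= n -> j <= n -> rank_entry x i j <= rank_entry y i j.
  move=> [px rx tx] [py ry ty]; apply: pillars_dominate.
  - exact: rank_entry_unit_steps.
  - exact: rank_entry_boundary.
  - move=> p; rewrite px => /setUP[pwL|/imsetP[q qL ->]]; first by rewrite rx ?ry.
    by rewrite tx ?ty.
move=> hu hu'; apply: rank_entry_inj => i j lin ljn.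
by apply/eqP; rewrite eqn_leq !dom.
Qed.


Import Order.TTheory GRing.Theory Num.Theory.
Local Open Scope ring_scope.

(** * Bruhat decomposition and ranks of corners *)

Section Bruhat.
Variables (K : fieldType) (n : nat).
Implicit Types (b g h : 'M[K]_n) (u w : 'S_n).

Lemma pid_mxE i (a c : 'I_n) : (pid_mx i : 'M[K]_n) a c = ((a == c) && (a < i)%N)%:R.
Proof. by rewrite mxE -val_eqE. Qed.

Lemma copid_mxE i (a c : 'I_n) : (copid_mx i : 'M[K]_n) a c = ((a == c) && (i <= a)%N)%:R.
Proof.
rewrite /copid_mx !mxE val_eqE; case: (a == c) => /=; last by rewrite subr0.
by case: ltnP => _; rewrite ?subrr ?subr0.
Qed.

Lemma mul_pid_mxE m i (g : 'M[K]_(n, m)) a c : (pid_mx i *m g) a c = g a c *+ (a < i)%N.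
Proof.
rewrite mxE (bigD1 a) //= big1 ?addr0 => [|l la].
  by rewrite pid_mxE eqxx mulr_natl.
by rewrite pid_mxE eq_sym (negPf la) mul0r.
Qed.

Lemma mul_mx_pidE m i (g : 'M[K]_(m, n)) a c : (g *m pid_mx i) a c = g a c *+ (c < i)%N.
Proof.
rewrite mxE (bigD1 c) //= big1 ?addr0 => [|l la].
  by rewrite pid_mxE eqxx mulr_natr.
by rewrite pid_mxE (negPf la) mulr0.
Qed.

Lemma mul_copid_mxE m i (g : 'M[K]_(n, m)) a c : (copid_mx i *m g) a c = g a c *+ (i <= a)%N.
Proof.
rewrite mxE (bigD1 a) //= big1 ?addr0 => [|l la].
  by rewrite copid_mxE eqxx mulr_natl.
by rewrite copid_mxE eq_sym (negPf la) mul0r.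
Qed.

(** The block of the rows of index at least [j] and the columns of index less
    than [i], extended by zeros; being a product with two projectors, its rank
    passes through matrix products. *)
Definition corner i j g : 'M[K]_n := copid_mx j *m g *m pid_mx i.

Lemma cornerE i j g a c : corner i j g a c = g a c *+ ((j <= a) && (c < i))%N.
Proof. by rewrite /corner mul_mx_pidE mul_copid_mxE -mulrnA mulnb. Qed.

Lemma upper_triangularP b :
  upper_triangular b <-> forall j, corner j j b = 0.
Proof.
split=> [tb j|tb a c ca].
  apply/matrixP => a c; rewrite cornerE mxE.
  by case: andP => [[ja cj]|] //; rewrite tb // (leq_trans cj).
have := congr1 (fun M : 'M_n => M a c) (tb a).
by rewrite cornerE mxE leqnn ca.
Qed.

Lemma upper_pid b j : upper_triangular b ->
  b *m pid_mx j = pid_mx j *m (b *m pid_mx j) :> 'M_n.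
Proof.
move/upper_triangularP/(_ j); rewrite /corner => h; rewrite -[LHS]subr0 -h /copid_mx.
by rewrite mulmxBl mul1mx mulmxBl opprB addrCA subrr addr0 mulmxA.
Qed.

Lemma upper_copid b j : upper_triangular b ->
  copid_mx j *m b = copid_mx j *m b *m copid_mx j :> 'M_n.
Proof.
by move/upper_triangularP/(_ j); rewrite /corner => h; rewrite {2}/copid_mx mulmxBr mulmx1 h subr0.
Qed.

Lemma upper_mul b h : upper_triangular b -> upper_triangular h ->
  upper_triangular (b *m h).
Proof.
move=> ub uh; apply/upper_triangularP => j; rewrite /corner.
rewrite mulmxA -mulmxA (upper_pid _ uh) !mulmxA.
by move/upper_triangularP/(_ j): ub; rewrite /corner => ->; rewrite !mul0mx.
Qed.

(** [b] maps the span of the first [j] basis vectors into itself, hence onto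
    itself by comparison of ranks. *)
Lemma upper_inv b : b \in unitmx -> upper_triangular b -> upper_triangular (invmx b).
Proof.
move=> ub tb; apply/upper_triangularP => j; rewrite /corner.
have sub : ((b *m pid_mx j : 'M_n)^T <= (pid_mx j : 'M[K]_n)^T)%MS.
  by rewrite (upper_pid j tb) trmx_mul submxMl.
have : ((pid_mx j : 'M[K]_n)^T <= (b *m pid_mx j : 'M_n)^T)%MS.
  rewrite -(geq_leqif (mxrank_leqif_sup sub)) !mxrank_tr.
  by rewrite -{1}(mulKmx ub (pid_mx j)) mxrankM_maxr.
move/submxP => [C /(congr1 trmx)]; rewrite trmx_mul !trmxK => ->.
rewrite !mulmxA mulmxKV // -mulmxA.
have -> : copid_mx j *m (pid_mx j *m C^T) = (copid_mx j *m pid_mx j) *m C^T :> 'M[K]_n.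
  by rewrite mulmxA.
have -> : copid_mx j *m pid_mx j = 0 :> 'M[K]_n.
  apply/matrixP => a c; rewrite mul_copid_mxE pid_mxE mxE.
  by case: leqP; rewrite ?andbF.
by rewrite mul0mx.
Qed.

Lemma upper_unit b : upper_triangular b -> (forall a, b a a != 0) -> b \in unitmx.
Proof.
move=> tb nz; rewrite unitmxE -det_tr det_trig.
  by rewrite unitfE; apply/prodf_neq0 => a _; rewrite mxE nz.
by apply/is_trig_mxP => a c ac; rewrite mxE tb.
Qed.

Definition perm_col u : 'M[K]_n := perm_mx (u^-1)%g.

Lemma perm_colE u a c : perm_col u a c = (a == u c)%:R.
Proof.
rewrite /perm_col !mxE; congr (nat_of_bool _)%:R.
by apply/eqP/eqP => [<-|->]; rewrite ?permKV ?permK.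
Qed.

Lemma perm_col_unit u : perm_col u \in unitmx.
Proof. exact: unitmx_perm. Qed.

Lemma perm_col_inv u : invmx (perm_col u) = perm_col (u^-1)%g.
Proof.
have e : perm_col (u^-1)%g *m perm_col u = 1%:M.
  by rewrite /perm_col -perm_mxM invgK mulgV perm_mx1.
by rewrite -[LHS]mul1mx -e mulmxK // perm_col_unit.
Qed.

(** In each step [V_(k+1) \ V_k] of the flag of columns of [g] take a vector whose
    last nonzero coordinate comes as early as possible. These last coordinates are
    different in different steps, since otherwise a combination of the two vectors
    would have an earlier one; so they form a permutation. *)
Lemma bruhat g : g \in unitmx ->
  exists u b h, [/\ b \in unitmx, upper_triangular b, h \in unitmx,
    upper_triangular h & g = b *m perm_col u *m h].
Proof.
move=> ug.
(* [new k y] puts [g *m y] into the step [k]; [low m x] says that the last nonzero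
   coordinate of [x] has index less than [m]. *)
pose new (k : 'I_n) (y : 'cV[K]_n) := y k 0 = 1 /\ forall l : 'I_n, (k < l)%N -> y l 0 = 0.
pose low m (x : 'cV[K]_n) := forall i : 'I_n, (m <= i)%N -> x i 0 = 0.
pose P (k : 'I_n) m := `[< exists2 y, new k y & low m (g *m y) >].
have exP (k : 'I_n) : exists m, P k m.
  exists n; apply/asboolP; exists (delta_mx k 0).
    by split=> [|l kl]; rewrite mxE ?eqxx // andbT -val_eqE /= gtn_eqF.
  by move=> i; rewrite leqNgt ltn_ord.
have /fin_all_exists2[u yP minu] : forall k : 'I_n, exists2 i : 'I_n,
    exists2 y, new k y & low i.+1 (g *m y) & forall y, new k y -> ~ low i (g *m y).
  move=> k; case: (ex_minnP (exP k)) => -[|m] /asboolP[y ny ly] mmin.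
    have gy0 : g *m y = 0 by apply/colP => i; rewrite ly // mxE.
    have y0 : y = 0 by rewrite -[y](mulKmx ug) gy0 mulmx0.
    by case: ny; rewrite y0 mxE => /eqP; rewrite eq_sym oner_eq0.
  have mn : (m < n)%N.
    rewrite ltnNge; apply/negP => nm.
    suff : (m < m)%N by rewrite ltnn.
    by apply: mmin; apply/asboolP; exists y => // i mi; have := ltn_ord i; lia.
  exists (Ordinal mn); first by exists y.
  move=> z nz lz; suff : (m < m)%N by rewrite ltnn.
  by apply: mmin; apply/asboolP; exists z.
have {yP} /fin_all_exists2[y yn yl] : forall k : 'I_n, exists2 y, new k y & low (u k).+1 (g *m y).
  by move=> k; case: (yP k) => y; exists y.
have piv k : (g *m y k) (u k) 0 != 0.
  apply/eqP => e; apply: (minu _ _ (yn k)) => i.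
  by rewrite leq_eqVlt => /orP[/eqP/val_inj <-|/yl].
have u_inj : injective u.
  have ne (k l : 'I_n) : (k < l)%N -> u k <> u l.
    move=> kl e; pose c := (g *m y l) (u l) 0 / (g *m y k) (u k) 0.
    apply: (minu l (y l - c *: y k)).
      have [y1 y2] := yn l; have [_ z2] := yn k.
      split=> [|i li]; first by rewrite !mxE y1 z2 // mulr0 subr0.
      by rewrite !mxE y2 // z2 ?mulr0 ?subr0 // (ltn_trans kl).
    move=> i ui; rewrite mulmxBr -scalemxAr.
    have -> : (g *m y l - c *: (g *m y k)) i 0 = (g *m y l) i 0 - c * (g *m y k) i 0.
      by rewrite !mxE.
    move: ui; rewrite leq_eqVlt => /orP[/eqP/val_inj <-|ui].
      by rewrite /c e divfK ?subrr // -e.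
    by rewrite (yl l) // (yl k) ?e // mulr0 subr0.
  move=> k l e; apply/val_inj; case: (ltngtP k l) => // h.
    by case: (ne _ _ h e).
  by case: (ne _ _ h (esym e)).
pose s : 'S_n := perm u_inj; pose h := \matrix_(i, k) y k i 0.
have th : upper_triangular h by move=> i k ki; rewrite mxE; case: (yn k) => _ ->.
have uh : h \in unitmx.
  apply: upper_unit => // a; rewrite mxE; case: (yn a) => -> _; exact: oner_neq0.
have ghE i k : (g *m h) i k = (g *m y k) i 0.
  by rewrite !mxE; apply: eq_bigr => l _; rewrite mxE.
pose b := g *m h *m perm_col (s^-1)%g.
have bE i k : b i k = (g *m y ((s^-1)%g k)) i 0.
  rewrite /b mxE (bigD1 ((s^-1)%g k)) //= big1 ?addr0 => [|l ls].
    by rewrite perm_colE eqxx mulr1 ghE.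
  by rewrite perm_colE (negPf ls) mulr0.
have us k : u ((s^-1)%g k) = k by rewrite -(permE u_inj) permKV.
have tb : upper_triangular b by move=> i k ki; rewrite bE yl // us.
exists s, b, (invmx h); split=> //.
- by apply: upper_unit => // a; rewrite bE -{2}(us a) piv.
- by rewrite unitmx_inv.
- exact: upper_inv.
by rewrite /b -perm_col_inv mulmxKV ?perm_col_unit // mulmxK.
Qed.

Lemma mxrank_perm_part u (D : {set 'I_n}) :
  (\rank (\sum_(k in D) (delta_mx (u k) k : 'M[K]_n))%R <= #|D|)%N.
Proof.
rewrite -sum1_card.
apply: (big_rec2 (fun (M : 'M[K]_n) m => (\rank M <= m)%N)) => [|k M m _ le_M].
  by rewrite mxrank0.
apply: leq_trans (mxrank_add _ _) _.
by rewrite mxrank_delta leq_add2l.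
Qed.

Lemma perm_part_sum u (D : {set 'I_n}) a c :
  (\sum_(k in D) (delta_mx (u k) k : 'M[K]_n)) a c = ((c \in D) && (a == u c))%:R.
Proof.
rewrite summxE; case: (boolP (c \in D)) => cD /=.
  rewrite (bigD1 c) //= big1 ?addr0 => [|k /andP[_ kc]].
    by rewrite mxE eqxx andbT.
  by rewrite mxE [c == k]eq_sym (negPf kc) andbF.
rewrite big1 // => k kD; rewrite mxE; case: (c =P k) => [ck|]; last by rewrite andbF.
by rewrite ck kD in cD.
Qed.

(** The columns of index less than [i] split into those with their 1 in the corner
    and those counted by the rank matrix; together they have rank [i]. *)
Lemma rank_corner_perm u i j : (i <= n)%N ->
  (\rank (corner i j (perm_col u)) + rank_entry u i j)%N = i.
Proof.
move=> lin.
pose D := [set k : 'I_n | (k < i)%N & (j <= u k)%N].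
pose E := [set k : 'I_n | (k < i)%N & (u k < j)%N].
have rE : rank_entry u i j = #|E| by [].
have DE : (#|D| + #|E|)%N = i.
  rewrite -cardsUI (_ : D :&: E = set0) ?cards0 ?addn0.
    rewrite -[RHS](rank_entry_nr u lin); apply: eq_card => k; rewrite !inE.
    by rewrite ltn_ord andbT -andb_orr; case: (ltnP (u k) j); rewrite ?orbT ?orbF ?andbT.
  by apply/setP => k; rewrite !inE; case: (ltnP (u k) j); rewrite ?andbF ?andbT.
have cD : corner i j (perm_col u) = \sum_(k in D) delta_mx (u k) k.
  apply/matrixP => a c; rewrite cornerE perm_part_sum perm_colE inE.
  by case: eqP => [->|]; rewrite ?andbT ?andbF ?mul0rn // andbC; case: andP.
have cE : pid_mx j *m perm_col u *m pid_mx i = \sum_(k in E) delta_mx (u k) k.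
  apply/matrixP => a c; rewrite mul_mx_pidE mul_pid_mxE perm_part_sum perm_colE inE.
  case: eqP => [->|]; rewrite ?andbT ?andbF ?mul0rn //.
  by case: (c < i)%N; case: (u c < j)%N.
apply/eqP; rewrite -[X in _ == X]DE rE eqn_add2r eqn_leq.
apply/andP; split; last first.
  have e : perm_col u *m pid_mx i = corner i j (perm_col u)
      + \sum_(k in E) delta_mx (u k) k :> 'M[K]_n.
    by rewrite -cE /corner -!mulmxDl /copid_mx subrK mul1mx.
  have : \rank (perm_col u *m pid_mx i : 'M[K]_n) = i.
    by rewrite eqmxMfull ?rank_pid_mx // row_full_unit perm_col_unit.
  rewrite -(leq_add2r #|E|) DE e => {1}<-; apply: leq_trans (mxrank_add _ _) _.
  by rewrite leq_add2l mxrank_perm_part.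
by rewrite cD mxrank_perm_part.
Qed.

Lemma rank_corner_le b h g i j : upper_triangular b -> upper_triangular h ->
  (\rank (corner i j (b *m g *m h)) <= \rank (corner i j g))%N.
Proof.
move=> tb th; rewrite /corner !mulmxA (upper_copid j tb).
rewrite -!mulmxA (upper_pid i th) !mulmxA.
rewrite -[_ *m h *m _]mulmxA; apply: leq_trans (mxrankM_maxl _ _) _.
by rewrite -!mulmxA; apply: leq_trans (mxrankM_maxr _ _) _; apply: mxrankM_maxr.
Qed.

Lemma rank_corner_bruhat b h u i j : b \in unitmx -> upper_triangular b ->
  h \in unitmx -> upper_triangular h -> (i <= n)%N ->
  (\rank (corner i j (b *m perm_col u *m h)) + rank_entry u i j)%N = i.
Proof.
move=> ub tb uh th lin; rewrite -[RHS](rank_corner_perm u j lin).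
apply/eqP; rewrite eqn_add2r eqn_leq rank_corner_le //=.
have {1}-> : perm_col u = invmx b *m (b *m perm_col u *m h) *m invmx h.
  by rewrite -!mulmxA mulmxV // mulmx1 mulKmx.
by apply: rank_corner_le; exact: upper_inv.
Qed.

(** The rank matrix of an inverse permutation is the transpose. *)
Lemma rank_corner_inv g i j : g \in unitmx -> (i <= n)%N -> (j <= n)%N ->
  (\rank (corner i j (invmx g)) + j = \rank (corner j i g) + i)%N.
Proof.
move=> /bruhat[u [b [h [ub tb uh th ->]]]] lin ljn.
have -> : invmx (b *m perm_col u *m h) = invmx h *m perm_col (u^-1)%g *m invmx b.
  set X := RHS; have e : X *m (b *m perm_col u *m h) = 1%:M.
    by rewrite /X -perm_col_inv !mulmxA mulmxKV // mulmxKV ?perm_col_unit // mulVmx.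
  by rewrite -[LHS]mul1mx -e mulmxK // !unitmx_mul ub perm_col_unit.
have := @rank_corner_bruhat b h u j i ub tb uh th ljn.
have := @rank_corner_bruhat (invmx h) (invmx b) (u^-1)%g i j.
rewrite rank_entryV !unitmx_inv; move=> /(_ uh (upper_inv uh th) ub (upper_inv ub tb) lin).
move=> A C; apply: (@addIn (rank_entry u j i)).
by rewrite addnAC A [RHS]addnAC C addnC.
Qed.

End Bruhat.

(** * Flags and Schubert varieties in terms of matrices *)

Section FlagMatrices.
Variables (K : fieldType) (n : nat).
Implicit Types (b g h : 'M[K]_n) (u w : 'S_n) (V : flag K n).

Lemma span_first_lin g (v : 'I_n -> 'cV[K]_n) k :
  (linfun (mulmx g) @: span_first v k)%VS = span_first (fun i => g *m v i) k.
Proof.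
rewrite /span_first limg_span -map_comp; congr <<_>>%VS.
by apply: eq_map => i /=; rewrite lfunE.
Qed.

Lemma span_first_col g k :
  span_first (fun i => col i g) k = (linfun (mulmx g) @: span_first (@std_basis K n) k)%VS.
Proof.
rewrite span_first_lin /span_first; congr <<_>>%VS.
by apply: eq_map => i; rewrite colE.
Qed.

Lemma mem_span_col g k x : g \in unitmx ->
  (x \in span_first (fun i => col i g) k)
  = [forall i : 'I_n, (k <= i)%N ==> ((invmx g *m x) i 0 == 0)].
Proof.
move=> ug; rewrite span_first_col.
have std1 : span_first (@std_basis K n) k = span_first (fun i => std_basis K ((1%g : 'S_n) i)) k.
  by rewrite /span_first; congr <<_>>%VS; apply: eq_map => a; rewrite perm1.
have -> : (x \in (linfun (mulmx g) @: span_first (@std_basis K n) k)%VS)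
    = (invmx g *m x \in span_first (@std_basis K n) k).
  apply/memv_imgP/idP => [[y yS ->]|xS]; first by rewrite lfunE /= mulKmx.
  by exists (invmx g *m x); rewrite // lfunE /= mulKVmx.
rewrite std1 mem_std_span; apply: eq_forallb => i; by rewrite perm1.
Qed.

Lemma span_col_sub g h : g \in unitmx -> h \in unitmx ->
  (forall k : 'I_n.+1, (span_first (fun i => col i h) k <= span_first (fun i => col i g) k)%VS)
  <-> upper_triangular (invmx g *m h).
Proof.
move=> ug uh; split=> [sub a c ca|tri k].
  have cn : (c.+1 < n.+1)%N by rewrite ltnS.
  have /span_firstP/(_ c (ltnSn c)) := sub (Ordinal cn).
  rewrite mem_span_col // => /forallP/(_ a); rewrite ca /= => /eqP.
  by rewrite colE mulmxA -colE mxE.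
apply/span_firstP => c ck; rewrite mem_span_col //; apply/forallP => a.
apply/implyP => ka; apply/eqP; rewrite colE mulmxA -colE mxE tri //.
exact: leq_trans ck ka.
Qed.

Lemma span_col_full g : g \in unitmx -> span_first (fun i => col i g) n = fullv.
Proof.
move=> ug; apply/eqP; rewrite eqEsubv subvf; apply/subvP => x _.
by rewrite mem_span_col //; apply/forallP => i; rewrite leqNgt ltn_ord.
Qed.

(** The dimension grows by at most one with [k] and goes from 0 to [n]. *)
Lemma dim_span_col g k : g \in unitmx -> (k <= n)%N ->
  \dim (span_first (fun i => col i g) k) = k.
Proof.
move=> ug kn; pose W k := span_first (fun i => col i g) k; rewrite -/(W k).
have W0 : \dim (W 0%N) = 0%N.
  apply/eqP; rewrite dimv_eq0 -subv0; exact/span_firstP.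
have Wn : \dim (W n) = n by rewrite /W span_col_full // dimvf /dim /= muln1.
have step l : (l < n)%N -> (\dim (W l.+1) <= (\dim (W l)).+1)%N.
  move=> ln; pose c := Ordinal ln.
  have sub : (W l.+1 <= W l + <[col c g]>)%VS.
    apply/span_firstP => i; rewrite ltnS leq_eqVlt => /orP[/eqP il|il].
      have -> : i = c by apply: val_inj.
      by rewrite (subvP (addvSr _ _)) ?memv_line.
    rewrite (subvP (addvSl _ _)) //.
    by have /span_firstP := subvv (W l); apply.
  apply: leq_trans (dimvS sub) _; apply: leq_trans (dimv_add_leqif _ _) _.
  by rewrite -[leqRHS]addn1 leq_add2l dim_vline; case: (_ != _).
have up d : (d <= n)%N -> (\dim (W d) <= d)%N.
  by elim: d => [|d IH] dn; rewrite ?W0 // (leq_trans (step d dn)) // ltnS IH // ltnW.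
have down d : (d <= n)%N -> (n - d <= \dim (W (n - d)%N))%N.
  elim: d => [|d IH] dn; first by rewrite subn0 Wn.
  have := IH (ltnW dn); have := step (n - d.+1)%N.
  have -> : (n - d.+1).+1 = (n - d)%N by lia.
  by move=> /(_ _); lia.
apply/eqP; rewrite eqn_leq up //=.
by have := down (n - k)%N (leq_subr _ _); rewrite subKn.
Qed.

Lemma exists_flag g : g \in unitmx -> exists V, matrix_flag g V.
Proof.
move=> ug; pose F := [ffun k : 'I_n.+1 => span_first (fun i => col i g) k].
have fF : is_flag F.
  apply/andP; split.
    by apply/forallP => k; rewrite ffunE dim_span_col // -ltnS.
  apply/forallP => i; apply/forallP => j; apply/implyP => ij; rewrite !ffunE.
  apply/span_firstP => a ai; have /span_firstP := subvv (span_first (fun i => col i g) j).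
  by apply; exact: leq_trans ai ij.
by exists (exist _ F fF) => k; rewrite /flag_space /= ffunE.
Qed.

Lemma matrix_flag_mulr g h V : g \in unitmx -> h \in unitmx -> upper_triangular h ->
  matrix_flag g V -> matrix_flag (g *m h) V.
Proof.
move=> ug uh th gV k; rewrite gV; have ugh : g *m h \in unitmx by rewrite unitmx_mul ug.
apply/eqP; rewrite eqEsubv; apply/andP; split.
  apply: (span_col_sub ugh ug).2.
  have -> : invmx (g *m h) *m g = invmx h.
    rewrite -[RHS]mul1mx -(mulVmx ugh) -!mulmxA; congr (_ *m _).
    by rewrite mulmxV // mulmx1.
  exact: upper_inv.
by apply: (span_col_sub ug ugh).2; rewrite mulKmx.
Qed.

Lemma matrix_flag_upper g g' V : g \in unitmx -> g' \in unitmx ->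
  matrix_flag g V -> matrix_flag g' V ->
  exists h, [/\ h \in unitmx, upper_triangular h & g' = g *m h].
Proof.
move=> ug ug' gV gV'; exists (invmx g *m g'); split.
- by rewrite unitmx_mul unitmx_inv ug.
- by apply/span_col_sub => // k; rewrite -gV -gV'.
- by rewrite mulKVmx.
Qed.

Lemma schubert_cellP w V : schubert_cell w V <->
  exists b, [/\ b \in unitmx, upper_triangular b & matrix_flag (b *m perm_col K w) V].
Proof.
have e b k : span_first (fun i => col i (b *m perm_col K w)) k
    = (linfun (mulmx b) @: span_first (fun i => std_basis K (w i)) k)%VS.
  rewrite span_first_lin /span_first; congr <<_>>%VS; apply: eq_map => i.
  rewrite colE -mulmxA -colE; congr (_ *m _); apply/colP => a.
  by rewrite mxE perm_colE mxE eqxx andbT.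
by split=> -[b [ub tb bV]]; exists b; split=> // k; rewrite bV e.
Qed.

Lemma bruhat_cell g V u b h : b \in unitmx -> upper_triangular b ->
  h \in unitmx -> upper_triangular h -> g = b *m perm_col K u *m h ->
  matrix_flag g V -> schubert_cell u V.
Proof.
move=> ub tb uh th e gV; apply/schubert_cellP; exists b; split=> //.
have -> : b *m perm_col K u = g *m invmx h by rewrite e mulmxK.
apply: matrix_flag_mulr => //; rewrite ?unitmx_inv //; last exact: upper_inv.
by rewrite e !unitmx_mul ub uh perm_col_unit.
Qed.

End FlagMatrices.

Section Minors.
Variables (K : fieldType) (n : nat).

(** The compressions take the place of the minors of size [c.+1]: they too are
    polynomials in the entries of [A], and if the rank is larger than [c] then the
    Gaussian elimination of [A] provides one that is the identity matrix. *)
Lemma rank_compressions m c (A : 'M[K]_(m, n)) :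
  (\rank A <= c)%N <-> forall (P : 'M_(c.+1, m)) (Q : 'M_(n, c.+1)), \det (P *m A *m Q) = 0.
Proof.
split=> [rA P Q|det0].
  apply/eqP; apply: contraTT rA => d0; rewrite -ltnNge.
  have u : P *m A *m Q \in unitmx by rewrite unitmxE unitfE.
  rewrite -[X in (X <= _)%N](mxrank_unit u).
  by apply: leq_trans (mxrankM_maxl _ _) _; apply: mxrankM_maxr.
rewrite leqNgt; apply/negP => cr.
have := det0 (pid_mx c.+1 *m invmx (col_ebase A)) (invmx (row_ebase A) *m pid_mx c.+1).
rewrite -[X in _ *m X *m _]mulmx_ebase !mulmxA.
rewrite mulmxKV ?col_ebase_unit // -!mulmxA mulKVmx ?row_ebase_unit //.
have cm : (c.+1 <= m)%N := leq_trans cr (rank_leq_row A).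
have cn : (c.+1 <= n)%N := leq_trans cr (rank_leq_col A).
rewrite !mul_pid_mx (_ : minn _ _ = c.+1); last by lia.
by rewrite pid_mx_1 det1 => /eqP; rewrite oner_eq0.
Qed.

Definition generic_mx : 'M[{mpoly K[n * n]}]_n := \matrix_(a, c) 'X_(mxvec_index a c).

Lemma generic_mxE (g : 'M[K]_n) :
  map_mx (meval (mxvec g 0)) generic_mx = g.
Proof. by apply/matrixP => a c; rewrite !mxE mevalXU mxvecE. Qed.

Definition compression_poly c (P : 'M[K]_(c, n)) (Q : 'M[K]_(n, c)) : {mpoly K[n * n]} :=
  \det (map_mx (@mpolyC _ _) P *m generic_mx *m map_mx (@mpolyC _ _) Q).

Lemma compression_polyE c (P : 'M[K]_(c, n)) (Q : 'M[K]_(n, c)) g :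
  (compression_poly P Q).@[mxvec g 0] = \det (P *m g *m Q).
Proof.
rewrite /compression_poly -det_map_mx !map_mxM generic_mxE; congr (\det (_ *m _ *m _));
  apply/matrixP => a d; rewrite !mxE; exact: mevalC.
Qed.

End Minors.

Section ChartSchubert.
Variables (K : numFieldType) (n : nat).
Implicit Types (b g h : 'M[K]_n) (u w : 'S_n) (V : flag K n).

(** Quantified over all matrices of the flag, so that no choice of one of them
    enters. *)
Definition rank_locus i j c V :=
  forall g, g \in unitmx -> matrix_flag g V -> (\rank (corner i j g) <= c)%N.

Lemma rank_locus_matrix i j c g V : g \in unitmx -> matrix_flag g V ->
  rank_locus i j c V <-> (\rank (corner i j g) <= c)%N.
Proof.
move=> ug gV; split=> [|le g' ug' gV']; first exact.
have [h [uh th ->]] := matrix_flag_upper ug ug' gV gV'.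
have := rank_corner_le g i j (b := 1%:M) _ th; rewrite mul1mx.
move=> /(_ _)/leq_trans; apply=> // a d da.
by rewrite mxE; case: eqP da => // ->; rewrite ltnn.
Qed.

Lemma zariski_closed_rank_locus i j c : zariski_closed (rank_locus i j c).
Proof.
exists (fun p => exists (P : 'M[K]_(c.+1, n)) (Q : 'M[K]_(n, c.+1)),
  p = compression_poly (P *m copid_mx j) (pid_mx i *m Q)) => g V ug gV.
have E (P : 'M[K]_(c.+1, n)) (Q : 'M[K]_(n, c.+1)) :
    P *m copid_mx j *m g *m (pid_mx i *m Q) = P *m corner i j g *m Q.
  by rewrite /corner !mulmxA.
rewrite (rank_locus_matrix i j c ug gV) rank_compressions; split.
  by move=> h p [P [Q ->]]; rewrite compression_polyE E h.
by move=> h P Q; rewrite -E -compression_polyE; apply: h; exists P, Q.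
Qed.

Lemma horner_punctured (q : {poly K}) : (forall s, s != 0 -> q.[s] = 0) -> q = 0.
Proof.
move=> q0; apply: contraTeq (leqnn (size q)) => nz; rewrite -ltnNge.
pose rs := [seq k.+1%:R : K | k <- iota 0 (size q)].
have {1}<- : size rs = size q by rewrite size_map size_iota.
apply: max_poly_roots => //.
  by apply/allP => _ /mapP[k _ ->]; apply/rootP/q0; rewrite pnatr_eq0.
rewrite map_inj_uniq ?iota_uniq // => k l /eqP.
by rewrite eqr_nat eqSS => /eqP.
Qed.

Lemma meval_line m (p : {mpoly K[m]}) (x y : 'I_m -> K) :
  exists q : {poly K}, forall s, q.[s] = p.@[fun i => x i + s * y i].
Proof.
exists (\sum_(t <- msupp p) p@_t *: \prod_i ((x i)%:P + y i *: 'X) ^+ t i) => s.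
rewrite horner_sum mevalE; apply: eq_bigr => t _; rewrite hornerZ horner_prod.
congr (_ * _); apply: eq_bigr => i _.
by rewrite horner_exp hornerD hornerC hornerZ hornerX mulrC.
Qed.

(** For [s != 0] the columns [a] and [c] on the left are [e_(w c) + s e_(w a)] and
    [e_(w a)]. Subtracting [s^-1] times the first from the second leaves
    [s e_(w a) + e_(w c)] and [- s^-1 e_(w c)], which is the matrix of [w] up to an
    upper triangular matrix, because [w c < w a]. *)
Lemma swap_factor w (a c : 'I_n) (s : K) : s != 0 -> (a < c)%N -> (w c < w a)%N ->
  exists b h, [/\ b \in unitmx, upper_triangular b, h \in unitmx, upper_triangular h &
    perm_col K (tperm a c * w)%g + s *: delta_mx (w a) a = b *m perm_col K w *m h].
Proof.
move=> s0 ac wca.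
have ca : c != a by rewrite -val_eqE gtn_eqF.
pose h : 'M[K]_n := 1%:M - s^-1 *: delta_mx a c.
pose b : 'M[K]_n := \matrix_(x, y) ((x == y)%:R * (if y == w a then s else if y == w c then - s^-1 else 1)
   + (x == w c)%:R * (y == w a)%:R).
have th : upper_triangular h.
  move=> x y yx; rewrite !mxE -val_eqE gtn_eqF //.
  case: eqP => [xa|]; case: eqP => [yc|]; rewrite ?mulr0 ?subr0 //.
  by move: yx; rewrite xa yc ltnNge ltnW.
have uh : h \in unitmx.
  apply: upper_unit => // x; rewrite !mxE eqxx.
  have -> : (x == a) && (x == c) = false.
    by apply/andP => -[/eqP-> /eqP e]; rewrite e eqxx in ca.
  by rewrite mulr0 subr0 oner_neq0.
have tb : upper_triangular b.
  move=> x y yx; rewrite !mxE -val_eqE gtn_eqF // mul0r add0r.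
  case: eqP => [xa|]; case: eqP => [yc|]; rewrite ?mulr0 ?mul0r //.
  by move: yx; rewrite xa yc ltnNge ltnW.
have ub : b \in unitmx.
  apply: upper_unit => // x; rewrite !mxE eqxx mul1r.
  have -> : (x == w c)%:R * (x == w a)%:R = 0 :> K.
    rewrite -natrM mulnb; case: eqP => [->|//]; case: eqP => // e.
    by move: wca; rewrite e ltnn.
  rewrite addr0; case: ifP => // _; case: ifP => _; last exact: oner_neq0.
  by rewrite oppr_eq0 invr_eq0.
exists b, (invmx h); split=> //; [by rewrite unitmx_inv|exact: upper_inv|].
suff <- : (perm_col K (tperm a c * w)%g + s *: delta_mx (w a) a) *m h = b *m perm_col K w.
  by rewrite mulmxK.
apply/matrixP => x y.
have -> : (b *m perm_col K w) x y = b x (w y).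
  rewrite mxE (bigD1 (w y)) //= big1 ?addr0 => [|l ls].
    by rewrite perm_colE eqxx mulr1.
  by rewrite perm_colE (negPf ls) mulr0.
set G := (perm_col K _ + _).
have GE z : G x z = (x == w (tperm a c z))%:R + s * ((x == w a) && (z == a))%:R.
  by rewrite /G mxE perm_colE permM !mxE.
have -> : (G *m h) x y = G x y - s^-1 * (G x a * (y == c)%:R).
  rewrite /h mulmxBr mulmx1 -scalemxAr [LHS]mxE [X in _ + X]mxE [X in _ - X]mxE.
  congr (_ - _ * _); rewrite mxE (bigD1 a) //= big1 ?addr0 => [|l la].
    by rewrite [delta_mx _ _ _ _]mxE eqxx.
  by rewrite [delta_mx _ _ _ _]mxE (negPf la) mulr0.
rewrite !GE tpermL eqxx andbT mxE !(inj_eq perm_inj).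
have [->|ya] := eqVneq y a.
  by rewrite tpermL andbT [a == c]eq_sym (negPf ca) mulr0n mulr1n; ring.
have [->|yc] := eqVneq y c.
  by rewrite tpermR andbF mulr0n mulr1n; field.
by rewrite tpermD 1?eq_sym // andbF mulr0n; ring.
Qed.

Lemma rank_entry_swap w (a c : 'I_n) i j : (a < c)%N -> (w c < w a)%N -> (i <= n)%N ->
  rank_entry (tperm a c * w)%g i j
  = (rank_entry w i j + ((a < i <= c) && (w c < j <= w a)))%N.
Proof.
move=> ac wca; elim: i => [|i IH] lin; first by rewrite !rank_entry0l ltn0.
rewrite !(rank_entryS _ (Ordinal lin)) /= {}IH ?(ltnW lin) // permM.
have [ia|ia] := eqVneq (Ordinal lin) a.
  rewrite ia tpermL; have -> : i = a by rewrite -ia.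
  by move: (rank_entry w a j) => ?; lia.
have [ic|ic] := eqVneq (Ordinal lin) c.
  rewrite ic tpermR; have -> : i = c by rewrite -ic.
  by move: (rank_entry w c j) => ?; lia.
rewrite tpermD 1?eq_sym //; move: ia ic; rewrite -!val_eqE /=.
by move: (rank_entry w i j) (w (Ordinal lin)) => ? [??] /=; lia.
Qed.

(** Each flag of the second cell is the value at [s = 0] of a line of matrices
    which for [s != 0] belong to the first cell. *)
Lemma closed_swap w (a c : 'I_n) (Z : flag K n -> Prop) : zariski_closed Z ->
  (a < c)%N -> (w c < w a)%N -> (forall U, schubert_cell w U -> Z U) ->
  forall U, schubert_cell (tperm a c * w)%g U -> Z U.
Proof.
move=> [S SZ] ac wca wZ U /schubert_cellP[b [ub tb bU]].
have ubw : b *m perm_col K (tperm a c * w)%g \in unitmx.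
  by rewrite unitmx_mul ub perm_col_unit.
apply/(SZ _ _ ubw bU) => p Sp.
pose x i := mxvec (b *m perm_col K (tperm a c * w)%g) 0 i.
pose y i := mxvec (b *m delta_mx (w a) a) 0 i.
have [q qE] := meval_line p x y.
have lineE s : (fun i => x i + s * y i)
    =1 mxvec (b *m (perm_col K (tperm a c * w)%g + s *: delta_mx (w a) a)) 0.
  by move=> i; rewrite mulmxDr -scalemxAr linearD linearZ !mxE.
have q0 : q = 0.
  apply: horner_punctured => s s0; rewrite qE (meval_eq _ (lineE s)).
  have [b' [h [ub' tb' uh th e]]] := swap_factor s0 ac wca.
  set g := b *m _; have ge : g = (b *m b') *m perm_col K w *m h by rewrite /g e !mulmxA.
  have ug : g \in unitmx by rewrite ge !unitmx_mul ub ub' uh perm_col_unit.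
  have [V gV] := exists_flag ug; apply: (SZ _ _ ug gV).1 => //.
  apply: wZ; apply: bruhat_cell ge gV => //; first by rewrite unitmx_mul ub.
  exact: upper_mul.
have := qE 0; rewrite q0 horner0 (meval_eq _ (lineE 0)) scale0r addr0.
by move=> <-.
Qed.

(** Let [a] be the first index where [u] and [w] differ; then [u a < w a]. Let [c]
    be the first index after [a] with [u a <= w c < w a]. The swap adds 1 to the
    rank matrix of [w] exactly on a rectangle, and there [u] has room for it: it has
    the value [u a] in addition, while by the choice of [c] no value of [w] between
    [a] and [c] comes in. *)
Lemma bruhat_step u w :
  (forall i j, (i <= n)%N -> (j <= n)%N -> (rank_entry w i j <= rank_entry u i j)%N) ->
  u != w ->
  exists a c : 'I_n, [/\ (a < c)%N, (w c < w a)%N &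
    forall i j, (i <= n)%N -> (j <= n)%N ->
      (rank_entry (tperm a c * w)%g i j <= rank_entry u i j)%N].
Proof.
move=> dom uw.
have exa : exists k, [exists a : 'I_n, (a == k :> nat) && (u a != w a)].
  have : [exists a : 'I_n, u a != w a].
    apply: contraNT uw => /existsPn h; apply/eqP/permP => a.
    by apply/eqP; have := h a; rewrite negbK.
  by case/existsP => a ua; exists a; apply/existsP; exists a; rewrite eqxx.
case: (ex_minnP exa) => _ /existsP[a /andP[/eqP<- uwa]] mina {exa}.
have same (k : 'I_n) : (k < a)%N -> u k = w k.
  move=> ka; apply/eqP; apply: contraTT ka => ne; rewrite -leqNgt; apply: mina.
  by apply/existsP; exists k; rewrite eqxx.
have rka i j : (i <= a)%N -> rank_entry u i j = rank_entry w i j.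
  elim: i => [|i IH] ia; first by rewrite !rank_entry0l.
  have lin : (i < n)%N := leq_trans ia (ltnW (ltn_ord a)).
  by rewrite !(rank_entryS _ (Ordinal lin)) /= IH ?(ltnW ia) // same.
have lt_ua : (u a < w a)%N.
  rewrite ltn_neqAle val_eqE uwa leqNgt /=; apply/negP => wu.
  have := dom a.+1 (w a).+1 (ltn_ord a) (ltn_ord _).
  by rewrite !rank_entryS rka // ltnSn [(u a < _)%N]ltnS [(u a <= _)%N]leqNgt wu; lia.
have exc : exists k, [exists c : 'I_n, [&& c == k :> nat, (a < c)%N & (u a <= w c < w a)%N]].
  pose c := (w^-1)%g (u a); have wc : w c = u a by rewrite permKV.
  exists c; apply/existsP; exists c; rewrite eqxx wc leqnn lt_ua /= andbT.
  case: (ltngtP a c) => // [ca|/val_inj ac].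
    by move: (same _ ca); rewrite wc => /perm_inj e; rewrite e ltnn in ca.
  by move: lt_ua; rewrite -wc -ac ltnn.
case: (ex_minnP exc) => _ /existsP[c /and3P[/eqP<- ac /andP[uc cw]]] minc {exc}.
exists a, c; split=> // i j lin ljn; rewrite rank_entry_swap //.
case: (boolP (_ && _)) => [/andP[/andP[ai ic] /andP[cj ja]]|_]; last by rewrite addn0 dom.
have gap (k : 'I_n) : (a < k)%N -> (k < c)%N -> ~~ (u a <= w k < w a)%N.
  move=> ak kc; apply/negP => h; move: kc; rewrite ltnNge => /negP; apply.
  by apply: minc; apply/existsP; exists k; rewrite eqxx ak.
have Hw d : (a + d < c)%N ->
    (rank_entry w (a + d).+1 j + rank_entry w a (u a)
     = rank_entry w a j + rank_entry w (a + d).+1 (u a))%N.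
  elim: d => [|d IH] adc.
    by rewrite addn0 !rank_entryS ltnNge ja ltnNge (ltnW lt_ua) /= !addn0.
  have lin' : ((a + d).+1 < n)%N by have := ltn_ord c; lia.
  rewrite addnS in adc *; have {IH} := IH (ltnW adc).
  rewrite !(rank_entryS _ (Ordinal lin')) /=.
  have := gap (Ordinal lin') _ adc; rewrite /= ltnS leq_addr => /(_ isT).
  by move: (w (Ordinal lin')) => [v _] /=; lia.
have Hu d : (a + d < n)%N ->
    (rank_entry u a j + rank_entry u (a + d).+1 (u a) + 1
     <= rank_entry u (a + d).+1 j + rank_entry u a (u a))%N.
  elim: d => [|d IH] adn.
    by rewrite addn0 !rank_entryS ltnn (leq_ltn_trans uc cj); lia.
  rewrite addnS in adn *; have {IH} := IH (ltnW adn).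
  rewrite !(rank_entryS _ (Ordinal adn)) /=.
  have := leq_ltn_trans uc cj.
  by move: (u (Ordinal adn)) => [v _] /=; lia.
have ltc : (a + (i - a.+1) < c)%N by lia.
have := Hw _ ltc; have := Hu _ (ltn_trans ltc (ltn_ord c)).
have -> : (a + (i - a.+1)).+1 = i by lia.
have := dom i (u a) lin (ltnW (ltn_ord _)); rewrite !(rka a _ (leqnn _)); lia.
Qed.

Definition rank_gap u w := (\sum_(p : 'I_n.+1 * 'I_n.+1) (rank_entry u p.1 p.2 - rank_entry w p.1 p.2))%N.

(** Induction on the sum of the differences of the two rank matrices. *)
Lemma bruhat_closure u w :
  (forall i j, (i <= n)%N -> (j <= n)%N -> (rank_entry w i j <= rank_entry u i j)%N) ->
  forall Z : flag K n -> Prop, zariski_closed Z ->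
  (forall U, schubert_cell w U -> Z U) -> forall U, schubert_cell u U -> Z U.
Proof.
move=> dom Z cZ; have [m] := ubnP (rank_gap u w).
elim: m => // m IH in w dom *; rewrite ltnS => gm wZ.
have [->//|uw] := eqVneq u w.
have [a [c [ac wca dom']]] := bruhat_step dom uw.
apply: (IH _ dom' _ (closed_swap cZ ac wca wZ)).
apply: leq_trans gm; rewrite /rank_gap.
have ian : (a.+1 < n.+1)%N by rewrite ltnS.
have jan : (w a < n.+1)%N by rewrite ltnS ltnW.
pose p0 : 'I_n.+1 * 'I_n.+1 := (Ordinal ian, Ordinal jan).
rewrite (bigD1 p0) //= [in X in (_ < X)%N](bigD1 p0) //= -addSn leq_add //.
  have := dom' a.+1 (w a) (ltn_ord a) (ltnW (ltn_ord _)).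
  rewrite rank_entry_swap ?(ltn_ord a) // ltnSn ac wca leqnn /=.
  by lia.
apply: leq_sum => -[[i lin] [j ljn]] _ /=.
by rewrite leq_sub2l // rank_entry_swap // leq_addr.
Qed.

Lemma schubert_variety_rank w V g i j : g \in unitmx -> matrix_flag g V ->
  (i <= n)%N -> schubert_variety w V -> (\rank (corner i j g) + rank_entry w i j <= i)%N.
Proof.
move=> ug gV lin wV.
have ri : (rank_entry w i j <= i)%N.
  by rewrite -[leqRHS](rank_corner_perm K w j lin) leq_addl.
rewrite addnC -(leq_subRL _ ri).
have : rank_locus i j (i - rank_entry w i j) V.
  apply: wV; first exact: zariski_closed_rank_locus.
  move=> U /schubert_cellP[b [ub tb bU]].
  have ubw : b *m perm_col K w \in unitmx by rewrite unitmx_mul ub perm_col_unit.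
  apply/(rank_locus_matrix i j _ ubw bU).
  have t1 : upper_triangular (1%:M : 'M[K]_n).
    by move=> x y yx; rewrite mxE -val_eqE gtn_eqF.
  have := rank_corner_bruhat w j ub tb (unitmx1 _ _) t1 lin.
  by rewrite mulmx1 => e; rewrite leq_subRL // addnC e.
exact.
Qed.

(** The flag lies in some Bruhat cell, of a permutation [u]; its rank conditions
    say that [u] dominates [w] at the pillars of [w], hence everywhere. *)
Lemma rank_schubert_variety w V g : g \in unitmx -> matrix_flag g V ->
  (forall p, p \in pillars w ->
     (\rank (corner p.1 p.2 g) + rank_entry w p.1 p.2 <= p.1)%N) ->
  schubert_variety w V.
Proof.
move=> ug gV pil; have [u [b [h [ub tb uh th e]]]] := bruhat ug.
have uV := bruhat_cell ub tb uh th e gV.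
move=> Z cZ wZ; apply: (bruhat_closure _ cZ wZ uV).
apply: pillars_dominate; first exact: rank_entry_unit_steps.
  exact: rank_entry_boundary.
move=> p /pil; rewrite e.
have := rank_corner_bruhat u p.2 ub tb uh th (ltnW (ltn_ord p.1)).
lia.
Qed.

End ChartSchubert.

(** * Tangent cones of arbitrary sets of points *)

Section Separation.
Variables (K : fieldType) (r : nat).

(** A maximal number of independent vectors of [E] spans all of [E], and a vector
    outside this span is separated from it by a linear form. *)
Lemma span_separation (E : 'rV[K]_r -> Prop) (t : 'rV[K]_r) :
  (forall c : 'cV[K]_r, (forall e, E e -> e *m c = 0) -> t *m c = 0) ->
  exists m (M : 'M[K]_(m, r)), (forall i, E (row i M)) /\ (t <= M)%MS.
Proof.
move=> sep.
pose P k := `[< exists m (M : 'M[K]_(m, r)), (forall i, E (row i M)) /\ \rank M = k >].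
have exP : exists k, P k.
  by exists 0%N; apply/asboolP; exists 0%N, 0; split=> [[]//|]; rewrite mxrank0.
have ubP k : P k -> (k <= r)%N by move=> /asboolP[m [M [_ <-]]]; exact: rank_leq_col.
case: (ex_maxnP exP ubP) => k /asboolP[m [M [EM rM]]] kmax.
exists m, M; split=> //.
have absorb e : E e -> (e <= M)%MS.
  move=> Ee; have sub : (M <= col_mx M e)%MS by rewrite -addsmxE addsmxSl.
  apply: (@submx_trans _ _ _ _ _ e (col_mx M e)); first by rewrite -addsmxE addsmxSr.
  rewrite -(geq_leqif (mxrank_leqif_sup sub)) rM; apply: kmax; apply/asboolP.
  exists (m + 1)%N, (col_mx M e); split=> // i; rewrite -(splitK i).
  by case: (split i) => j /=; rewrite ?rowKu ?rowKd ?EM // ord1 row_id.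
rewrite submxE; apply/eqP/matrixP.
have col0 j : t *m col j (cokermx M) = 0.
  apply: sep => e /absorb; rewrite submxE => /eqP e0.
  by rewrite colE mulmxA e0 mul0mx.
move=> a b; have := congr1 (fun A : 'cV_1 => A a 0) (col0 b).
by rewrite colE mulmxA -colE mxE [RHS]mxE [X in _ -> _ = X]mxE.
Qed.
End Separation.

Section Cones.
Variables (K : fieldType) (N : nat).
Local Notation point := ('I_N -> K).
Local Notation poly := {mpoly K[N]}.
Implicit Types (S : point -> Prop) (v x y z : point) (p q : poly).

(** Lowest homogeneous parts are quantified through their degree, so that a zero
    part imposes nothing. *)
Definition cone S v := forall p d, (forall x, S x -> p.@[x] = 0) ->
  (forall e, (e < d)%N -> pihomog mdeg e p = 0) -> (pihomog mdeg d p).@[v] = 0.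

(** The substitute for a curve in [S] with tangent [v]: on a curve [x(t)] with
    first term [t v] the coefficient of [t^k] of a polynomial of order [k] is the
    value of its part of degree [k] at [v]. Here this coefficient is replaced by a
    combination of values at points of [S]. If no combination had these values on
    the [q j] of degree at least [k], then by duality some combination of these
    [q j] would vanish on [S] without its part of degree [k] vanishing at [v]. *)
Lemma cone_functional S v r (q : 'I_r -> poly) (al : 'I_r -> nat) k : cone S v ->
  (forall j, q j \is (al j).-homog) ->
  exists m (x : 'I_m -> point) (u : 'I_m -> K), (forall i, S (x i)) /\
    forall j, (k <= al j)%N ->
      \sum_i u i * (q j).@[x i] = if al j == k then (q j).@[v] else 0.
Proof.
move=> Sv hq.
pose ev x : 'rV[K]_r := \row_j (if (k <= al j)%N then (q j).@[x] else 0).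
pose t : 'rV[K]_r := \row_j (if al j == k then (q j).@[v] else 0).
have [|m [M [EM /submxP[u tu]]]] := @span_separation K r (fun e => exists2 x, S x & e = ev x) t.
  move=> c c0; apply/matrixP => i0 i1; rewrite !ord1 {i0 i1} [RHS]mxE.
  pose p := \sum_(j | (k <= al j)%N) c j 0 *: q j.
  have pS x : S x -> p.@[x] = 0.
    move=> Sx; have := c0 (ev x) (ex_intro2 _ _ x Sx erefl).
    move=> /(congr1 (fun A : 'M_1 => A 0 0)); rewrite !mxE => <-.
    rewrite /p big_mkcond /= raddf_sum; apply: eq_bigr => j _; rewrite mxE.
    by case: ifP => _ /=; rewrite ?mevalZ ?meval0 ?mul0r // mulrC.
  have low e : (e < k)%N -> pihomog mdeg e p = 0.
    move=> ek; rewrite raddf_sum big1 // => j kj /=.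
    by rewrite linearZ /= (pihomog_ne0 _ (hq j)) ?scaler0 // gtn_eqF // (leq_trans ek).
  have := Sv p k pS low.
  have -> : pihomog mdeg k p = \sum_(j | (k <= al j)%N) c j 0 *: pihomog mdeg k (q j).
    by rewrite /p [LHS]raddf_sum; apply: eq_bigr => j _; rewrite /= linearZ.
  rewrite raddf_sum => <-; rewrite mxE big_mkcond [RHS]big_mkcond /=; apply: eq_bigr => j _ /=.
  rewrite mxE; case: (ltngtP (al j) k) => [ak|ak|ak].
  - by rewrite mul0r.
  - by rewrite (pihomog_ne0 _ (hq j)) ?gtn_eqF // scaler0 meval0 mul0r.
  - by rewrite pihomog_dE -?ak // mevalZ mulrC.
have /fin_all_exists2[x Sx Mx] : forall i : 'I_m, exists2 x, S x & row i M = ev x.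
  by move=> i; have [x] := EM i; exists x.
exists m, x, (u 0); split=> // j kj.
have := congr1 (fun A : 'rV_r => A 0 j) tu; rewrite !mxE => ->.
apply: eq_bigr => i _; congr (_ * _).
by have := congr1 (fun A : 'rV_r => A 0 j) (Mx i); rewrite !mxE kj => ->.
Qed.

Lemma homog_meval_scale d q (c : K) x : q \is d.-homog ->
  q.@[fun i => c * x i] = c ^+ d * q.@[x].
Proof.
move=> hq; rewrite !mevalE mulr_sumr big_seq [RHS]big_seq.
apply: eq_bigr => m mq; rewrite mulrCA; congr (_ * _).
have := dhomog_mf hq mq; rewrite /= => <-.
rewrite [mdeg m]mdegE expr_sum -big_split /=; apply: eq_bigr => i _.
by rewrite exprMn.
Qed.

Lemma cone_scale S v c : cone S v -> cone S (fun i => c * v i).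
Proof.
move=> Sv p d pS low; rewrite (homog_meval_scale _ _ (pihomogP mdeg d p)).
by rewrite Sv // mulr0.
Qed.

(* A term [f(x) g(z)], given by the degrees of [f] and [g] and by these two. *)
Local Notation term := (nat * nat * (poly * poly))%type.
Definition good_term w (t : term) :=
  [&& t.2.1 \is (t.1.1).-homog, t.2.2 \is (t.1.2).-homog & (w <= t.1.1 + t.1.2)%N].
Definition term_eval x z (t : term) := t.2.1.@[x] * t.2.2.@[z].

(** [G0] is the part of degree [w] of the polynomial [G] of order at least [w]. *)
Definition leading w (G G0 : point -> point -> K) := exists s : seq term,
  [/\ all (good_term w) s,
      forall x z, G x z = \sum_(t <- s) term_eval x z t &
      forall x z, G0 x z = \sum_(t <- s | (t.1.1 + t.1.2 == w)%N) term_eval x z t].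

(** A pair of tangent vectors is tangent to the product. For [k <= w] apply to [G]
    the functional of degree [k] in the first point and that of degree [w - k] in
    the second point. A term whose degrees are not these two has a larger degree in
    one of the points and is killed there; so the terms of these degrees vanish
    together at the pair. *)
Lemma leading_cone S S' v v' w G G0 : cone S v -> cone S' v' -> leading w G G0 ->
  (forall x z, S x -> S' z -> G x z = 0) -> G0 v v' = 0.
Proof.
move=> Sv Sv' [s [/allP gs GE G0E]] GS.
pose tt j := tnth (in_tuple s) j.
have gt j : good_term w (tt j) by apply: gs; exact: mem_tnth.
have h1 j : (tt j).2.1 \is ((tt j).1.1).-homog by have /and3P[] := gt j.
have h2 j : (tt j).2.2 \is ((tt j).1.2).-homog by have /and3P[] := gt j.
have part k : (k <= w)%N ->
    \sum_(j | ((tt j).1.1 == k) && ((tt j).1.2 == w - k)%N) term_eval v v' (tt j) = 0.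
  move=> kw; have [m [x [u [Sx fx]]]] := cone_functional k Sv h1.
  have [m' [z [u' [Sz gz]]]] := cone_functional (w - k)%N Sv' h2.
  transitivity (\sum_i \sum_l u i * (u' l * G (x i) (z l))); last first.
    by rewrite big1 // => i _; rewrite big1 // => l _; rewrite GS // !mulr0.
  have -> : \sum_i \sum_l u i * (u' l * G (x i) (z l))
      = \sum_j (\sum_i u i * (tt j).2.1.@[x i]) * (\sum_l u' l * (tt j).2.2.@[z l]).
    transitivity (\sum_i \sum_l \sum_j
        (u i * (tt j).2.1.@[x i]) * (u' l * (tt j).2.2.@[z l])).
      apply: eq_bigr => i _; apply: eq_bigr => l _.
      rewrite GE big_tnth !mulr_sumr; apply: eq_bigr => j _.
      by rewrite /term_eval -/(tt j); ring.
    under eq_bigr => i _ do rewrite exchange_big /=.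
    rewrite exchange_big /=; apply: eq_bigr => j _.
    by rewrite big_distrlr.
  rewrite big_mkcond; apply: eq_bigr => j _.
  have /and3P[_ _ wj] := gt j.
  have [kj|jk] := leqP k (tt j).1.1; have [lj|jl] := leqP (w - k)%N (tt j).1.2.
  - rewrite fx // gz //; case: eqP => _; last by rewrite mul0r.
    by case: eqP => _; rewrite ?mulr0.
  - rewrite fx // [in RHS]gtn_eqF ?mul0r; last by lia.
    by rewrite (@ltn_eqF (tt j).1.2) // andbF.
  - rewrite gz // [in RHS]gtn_eqF ?mulr0; last by lia.
    by rewrite ltn_eqF.
  - by lia.
rewrite G0E big_tnth.
rewrite (partition_big (fun j => inord (tt j).1.1 : 'I_w.+1) xpredT) //= big1 // => k _.
rewrite -[RHS](part k (leq_ord k)); apply: eq_bigl => j; rewrite -/(tt j).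
have [/eqP e|ne] := boolP ((tt j).1.1 + (tt j).1.2 == w)%N.
  have aw : ((tt j).1.1 < w.+1)%N by rewrite ltnS -e leq_addr.
  rewrite -val_eqE /= inordK //; have := ltn_ord k; lia.
by have := ltn_ord k; move/eqP: ne; lia.
Qed.

Lemma leading_ext w G G0 H H0 : leading w G G0 -> (forall x z, G x z = H x z) ->
  (forall x z, G0 x z = H0 x z) -> leading w H H0.
Proof.
move=> [s [gs GE G0E]] GH G0H; exists s; split=> // x z; first by rewrite -GH GE.
by rewrite -G0H G0E.
Qed.

Lemma leading_term w f g al be : f \is al.-homog -> g \is be.-homog -> (al + be = w)%N ->
  leading w (fun x z => f.@[x] * g.@[z]) (fun x z => f.@[x] * g.@[z]).
Proof.
move=> hf hg e; exists [:: (al, be, (f, g))]; split=> [|x z|x z].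
- by rewrite /= /good_term /= hf hg e leqnn.
- by rewrite big_seq1.
- by rewrite big_mkcond big_seq1 /= e eqxx.
Qed.

Lemma leading0 w : leading w (fun _ _ => 0) (fun _ _ => 0).
Proof. by exists [::]; split=> // x z; rewrite big_nil. Qed.

Lemma leading_const c : leading 0 (fun _ _ => c) (fun _ _ => c).
Proof.
have h1 : (c%:MP : poly) \is 0.-homog for mdeg.
  have -> : c%:MP = c *: 1 :> poly by rewrite -mul_mpolyC mulr1.
  exact/dhomogZ/dhomog1.
apply: leading_ext (leading_term h1 (dhomog1 _ _) (addn0 0%N)) _ _ => x z;
  by rewrite mevalC meval1 mulr1.
Qed.

Lemma leading_weaken w w' G G0 : leading w G G0 -> (w' < w)%N -> leading w' G (fun _ _ => 0).
Proof.
move=> [s [gs GE G0E]] ww; exists s; split=> // [|x z].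
  apply: sub_all gs => t /and3P[h1 h2 h3]; rewrite /good_term h1 h2 /=.
  by apply: leq_trans h3; exact: ltnW.
rewrite big_seq_cond big1 // => t /andP[ts /eqP e].
have /and3P[_ _] := allP gs t ts; rewrite e => h.
by have := leq_trans ww h; rewrite ltnn.
Qed.

Lemma leading_add w G G0 H H0 : leading w G G0 -> leading w H H0 ->
  leading w (fun x z => G x z + H x z) (fun x z => G0 x z + H0 x z).
Proof.
move=> [s [gs GE G0E]] [s' [gs' HE H0E]]; exists (s ++ s'); split=> [|x z|x z].
- by rewrite all_cat gs.
- by rewrite big_cat GE HE.
- by rewrite big_cat G0E H0E.
Qed.

Lemma leading_mul w w' G G0 H H0 : leading w G G0 -> leading w' H H0 ->
  leading (w + w') (fun x z => G x z * H x z) (fun x z => G0 x z * H0 x z).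
Proof.
move=> [s [gs GE G0E]] [s' [gs' HE H0E]].
pose mult (t t' : term) : term :=
  ((t.1.1 + t'.1.1)%N, (t.1.2 + t'.1.2)%N, (t.2.1 * t'.2.1, t.2.2 * t'.2.2)).
have multE x z t t' : term_eval x z (mult t t') = term_eval x z t * term_eval x z t'.
  by rewrite /term_eval /= !mevalM; ring.
exists [seq mult t t' | t <- s, t' <- s']; split=> [|x z|x z].
- apply/allP => _ /allpairsP[[t t'] /= [ts ts' ->]].
  have /and3P[h1 h2 h3] := allP gs t ts; have /and3P[h1' h2' h3'] := allP gs' t' ts'.
  by rewrite /good_term /= !dhomogM //= addnACA leq_add.
- rewrite GE HE big_allpairs_dep big_distrl /=; apply: eq_bigr => t _.
  by rewrite big_distrr; apply: eq_bigr => t' _; rewrite multE.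
- rewrite G0E H0E [RHS]big_mkcond big_allpairs_dep big_distrl /=.
  rewrite big_seq_cond big_mkcondr [RHS]big_seq; apply: eq_bigr => t ts.
  have /and3P[_ _ h] := allP gs t ts.
  rewrite [RHS]big_seq; case: eqP => [e|ne].
    rewrite big_distrr /= big_seq_cond big_mkcondr /=. apply: eq_bigr => t' ts' /=.
    by rewrite addnACA e eqn_add2l multE.
  rewrite big1 // => t' ts'; have /and3P[_ _ h'] := allP gs' t' ts'.
  by case: eqP => // /=; lia.
Qed.

Lemma leading_sum w (I : eqType) (r : seq I) (P : pred I) (G G0 : I -> point -> point -> K) :
  (forall i, i \in r -> P i -> leading w (G i) (G0 i)) ->
  leading w (fun x z => \sum_(i <- r | P i) G i x z) (fun x z => \sum_(i <- r | P i) G0 i x z).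
Proof.
elim: r => [|i r IH] h.
  by apply: leading_ext (leading0 w) _ _ => x z; rewrite big_nil.
have {}IH := IH (fun j jr => h j (mem_behead (s := i :: r) jr)).
have hi := h i (mem_head i r).
have [Pi|nPi] := boolP (P i).
  by apply: leading_ext (leading_add (hi Pi) IH) _ _ => x z; rewrite big_cons Pi.
by apply: leading_ext IH _ _ => x z; rewrite big_cons (negPf nPi).
Qed.

Lemma leading_exp w G G0 k : leading w G G0 ->
  leading (w * k) (fun x z => G x z ^+ k) (fun x z => G0 x z ^+ k).
Proof.
move=> h; elim: k => [|k IH].
  by rewrite muln0; apply: leading_ext (leading_const 1) _ _ => x z; rewrite expr0.
by rewrite mulnS; apply: leading_ext (leading_mul h IH) _ _ => x z; rewrite exprS.
Qed.

Lemma leading_prod (I : Type) (r : seq I) (w : I -> nat) (G G0 : I -> point -> point -> K) :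
  (forall i, leading (w i) (G i) (G0 i)) ->
  leading (\sum_(i <- r) w i) (fun x z => \prod_(i <- r) G i x z)
    (fun x z => \prod_(i <- r) G0 i x z).
Proof.
move=> h; elim: r => [|i r IH].
  by rewrite big_nil; apply: leading_ext (leading_const 1) _ _ => x z; rewrite big_nil.
by rewrite big_cons; apply: leading_ext (leading_mul (h i) IH) _ _ => x z; rewrite big_cons.
Qed.

Lemma leading_scale w c G G0 : leading w G G0 ->
  leading w (fun x z => c * G x z) (fun x z => c * G0 x z).
Proof. exact: leading_mul (leading_const c). Qed.

Lemma msupp_low p d m : (forall e, (e < d)%N -> pihomog mdeg e p = 0) ->
  m \in msupp p -> (d <= mdeg m)%N.
Proof.
move=> low; apply: contraTT; rewrite -ltnNge => md; rewrite mcoeff_msupp negbK.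
have [k hk] : exists k, (mmeasure mdeg p <= k)%N by exists (mmeasure mdeg p).
rewrite (pihomog_partitionE hk) raddf_sum big1 // => e _ /=.
have [em|em] := eqVneq (e : nat) (mdeg m); first by rewrite em low // mcoeff0.
by rewrite (dhomog_nemf_coeff (pihomogP mdeg e p)) // eq_sym.
Qed.

Lemma pihomog_meval p d v : (pihomog mdeg d p).@[v]
  = \sum_(m <- msupp p | mdeg m == d) p@_m * \prod_i v i ^+ m i.
Proof.
rewrite pihomogE raddf_sum; apply: eq_bigr => m _.
by rewrite /= mevalZ mevalX.
Qed.

End Cones.

(** * Schubert varieties in the chart *)

Section Chart.
Variables (K : numFieldType) (n : nat).
Local Notation N := #|{: lower_pos n}|.
Local Notation point := ('I_N -> K).
Implicit Types (x y z v : point) (w : 'S_n) (i j : 'I_n).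

Definition strict_mx x : 'M[K]_n :=
  \matrix_(i, j) oapp (fun l => x (enum_rank l)) 0 (insub (i, j) : option (lower_pos n)).

Definition chart_mx x : 'M[K]_n := 1%:M + strict_mx x.

Lemma strict_mx_pos x (k : 'I_N) : strict_mx x (val (enum_val k)).1 (val (enum_val k)).2 = x k.
Proof. by rewrite mxE -surjective_pairing valK /= enum_valK. Qed.

Lemma strict_mx0 x i j : (i <= j)%N -> strict_mx x i j = 0.
Proof. by move=> ij; rewrite mxE insubF //= ltnNge ij. Qed.

Lemma strict_mx_enum x i j (h : (j < i)%N) :
  strict_mx x i j = x (enum_rank (Sub (i, j) h : lower_pos n)).
Proof. by rewrite mxE insubT. Qed.

Lemma chart_mx_lower x : lower_unitriangular (chart_mx x).
Proof. by move=> i j ij; rewrite mxE strict_mx0 // addr0 mxE. Qed.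

Lemma lower_unitriangular_unit (X : 'M[K]_n) : lower_unitriangular X -> X \in unitmx.
Proof.
move=> lX; rewrite -unitmx_tr; apply: upper_unit => [i j ji|i]; rewrite mxE lX ?(ltnW ji) //.
  by rewrite -val_eqE ltn_eqF.
by rewrite eqxx oner_neq0.
Qed.

Lemma chart_mx_unit x : chart_mx x \in unitmx.
Proof. exact/lower_unitriangular_unit/chart_mx_lower. Qed.

Definition coords (X : 'M[K]_n) : point := fun k => chart_coord X (enum_val k).

Lemma chart_mxK (X : 'M[K]_n) : lower_unitriangular X -> chart_mx (coords X) = X.
Proof.
move=> lX; apply/matrixP => i j; have [ij|ji] := leqP i j.
  by rewrite chart_mx_lower // lX.
rewrite mxE strict_mx_enum /coords /chart_coord enum_rankK /= mxE -val_eqE gtn_eqF //.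
by rewrite add0r.
Qed.

Lemma coordsK x : coords (chart_mx x) =1 x.
Proof.
move=> k; rewrite /coords /chart_coord mxE strict_mx_pos mxE -val_eqE gtn_eqF ?add0r //.
exact: (valP (enum_val k)).
Qed.

Definition in_schubert w x := forall i j, (i <= n)%N -> (j <= n)%N ->
  (\rank (corner i j (chart_mx x)) + rank_entry w i j <= i)%N.

Lemma in_schubert_pillars w x :
  (forall p, p \in pillars w ->
    (\rank (corner p.1 p.2 (chart_mx x)) + rank_entry w p.1 p.2 <= p.1)%N) ->
  in_schubert w x.
Proof.
move=> pil; have [V xV] := exists_flag (chart_mx_unit x).
have wV := rank_schubert_variety (chart_mx_unit x) xV pil.
by move=> i j lin ljn; exact: schubert_variety_rank (chart_mx_unit x) xV lin wV.
Qed.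

Lemma vanishes_on_schubertP w (p : chart_poly K n) :
  vanishes_on_schubert w p <-> forall x, in_schubert w x -> p.@[x] = 0.
Proof.
split=> [pw x wx|pw X V lX XV wV]; last first.
  apply: pw => i j lin ljn; rewrite chart_mxK //.
  exact: schubert_variety_rank (lower_unitriangular_unit lX) XV lin wV.
have [V xV] := exists_flag (chart_mx_unit x).
have := pw _ V (chart_mx_lower x) xV; rewrite /chart_eval (meval_eq _ (coordsK x)); apply.
apply: rank_schubert_variety (chart_mx_unit x) xV _ => q qw.
by apply: wx; apply: ltnW.
Qed.

Lemma tangent_coneP w (v : lower_pos n -> K) :
  tangent_cone w v <-> cone (in_schubert w) (fun k => v (enum_val k)).
Proof.
split=> [wv p d pw low|wv p q /vanishes_on_schubertP pw [d [-> _ low]]]; last exact: wv.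
have [->|q0] := eqVneq (pihomog mdeg d p) 0; first by rewrite meval0.
apply: wv (pihomog mdeg d p) _ _; first exact/vanishes_on_schubertP/pw.
by exists d.
Qed.

End Chart.

(** * Tangent cones and flips *)

Section FlipCone.
Variables (K : numFieldType) (n : nat).
Local Notation N := #|{: lower_pos n}|.
Local Notation point := ('I_N -> K).
Implicit Types (x y z v : point) (w : 'S_n) (X Z Q : 'M[K]_n) (i j : 'I_n).
Variable a : nat.
Local Notation pid r := (@pid_mx K n n r).
Local Notation copid r := (@copid_mx K n r).
Local Notation P := (pid a).
Local Notation P' := (copid a).

(** The upper left block is that of [X] and the lower right block that of [Z]. The
    lower left block combines the columns of this block of [Z] and also the rows of
    this block of [X]. So the first [a] columns of the result are a left multiple of
    those of [X], and its last rows are a right multiple of those of [Z]. *)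
Definition splice Q X Z : 'M[K]_n :=
  P *m X *m P + P' *m Z *m P' + P' *m Z *m P *m Q *m P' *m X *m P.

Lemma pid_copid r s : (r <= s)%N ->
  [/\ (pid s *m pid r = pid r :> 'M[K]_n),
      (copid s *m pid r = 0 :> 'M[K]_n),
      (pid r *m copid s = 0 :> 'M[K]_n),
      (pid r *m pid s = pid r :> 'M[K]_n) &
      (copid r *m copid s = copid s :> 'M[K]_n)
      /\ (copid s *m copid r = copid s :> 'M[K]_n)].
Proof.
move=> rs; split; [| | | |split]; apply/matrixP => c d;
  rewrite ?mul_pid_mxE ?mul_copid_mxE ?pid_mxE ?copid_mxE ?mxE;
  case: (c =P d) => _ /=; rewrite ?mul0rn // -mulrnA mulnb;
  case: (ltnP c r) => h1; case: (ltnP c s) => h2; rewrite //=.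
all: by have := leq_trans h1 rs; rewrite ltnNge h2.
Qed.

Lemma splice_ll Q X Z r s : (r <= a)%N -> (s <= a)%N ->
  (\rank (corner r s (splice Q X Z)) <= \rank (corner r s X))%N.
Proof.
move=> ra sa; have [Pr P'r _ _ _] := pid_copid ra; have [_ _ _ _ [_ P's]] := pid_copid sa.
have [_ sP' _ _ [sP _]] := pid_copid sa.
pose G := P + P' *m Z *m P *m Q *m P'.
have e1 : splice Q X Z *m pid r = G *m (X *m pid r).
  rewrite /splice (mulmxDl (_ + _)) (mulmxDl (P *m _ *m _)).
  rewrite -!(mulmxA _ P (pid r)) -!(mulmxA _ P' (pid r)) Pr P'r mulmx0 addr0.
  by rewrite /G (mulmxDl P) !mulmxA.
have sPc : copid s *m P = P *m copid s.
  by rewrite /copid_mx mulmxBl mulmxBr mul1mx mulmx1; case: (pid_copid sa) => -> _ _ ->.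
have e2 : copid s *m G = G *m copid s.
  by rewrite /G (mulmxDr _ P) (mulmxDl P) sPc !mulmxA sP -!mulmxA P's.
rewrite /corner -mulmxA e1 (mulmxA _ G) e2 -mulmxA (mulmxA (copid s) X).
exact: mxrankM_maxr.
Qed.

Lemma splice_rr Q X Z r s : (a <= r)%N -> (a <= s)%N ->
  (\rank (corner r s (splice Q X Z)) <= \rank (corner r s Z))%N.
Proof.
move=> ar as_; have [_ sP _ _ [_ sP']] := pid_copid as_.
have [rP _ _ Pr _] := pid_copid ar.
pose H := P' + P *m Q *m P' *m X *m P.
have e1 : copid s *m splice Q X Z = copid s *m Z *m H.
  rewrite /splice /H (mulmxDr _ (_ + _)) (mulmxDr _ (P *m _ *m _)) (mulmxDr _ P').
  by rewrite !mulmxA sP sP' !mul0mx add0r.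
have rPc : P' *m pid r = pid r *m P'.
  by rewrite /copid_mx mulmxBl mulmxBr mul1mx mulmx1 rP Pr.
have e2 : H *m pid r = pid r *m H.
  rewrite /H (mulmxDl P') (mulmxDr _ P') rPc !mulmxA rP -!mulmxA Pr.
  by [].
rewrite /corner e1 -[_ *m Z *m H *m _]mulmxA e2 mulmxA; exact: mxrankM_maxl.
Qed.

Lemma mul_mx_copidE m r (g : 'M[K]_(m, n)) c d : (g *m copid r) c d = g c d *+ (r <= d)%N.
Proof.
rewrite mxE (bigD1 d) //= big1 ?addr0 => [|l la].
  by rewrite copid_mxE eqxx mulr_natr.
by rewrite copid_mxE (negPf la) mulr0.
Qed.

Definition bridge Q X Z i j :=
  \sum_l \sum_m (Z i l *+ (l < a)%N) * Q l m * (X m j *+ (a <= m)%N).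

Lemma spliceE Q X Z i j : splice Q X Z i j =
  if (i < a)%N then X i j *+ (j < a)%N
  else if (a <= j)%N then Z i j else bridge Q X Z i j.
Proof.
have e : P' *m Z *m P *m Q *m P' *m X *m P = P' *m ((Z *m P) *m Q *m (P' *m X)) *m P.
  by rewrite !mulmxA.
have b : ((Z *m P) *m Q *m (P' *m X)) i j = bridge Q X Z i j.
  rewrite mxE /bridge [RHS]exchange_big /=; apply: eq_bigr => m _; rewrite mul_copid_mxE [(_ *m Q) i m]mxE.
  by rewrite mulr_suml; apply: eq_bigr => l _; rewrite mul_mx_pidE.
have addE (A B : 'M[K]_n) : (A + B) i j = A i j + B i j by rewrite mxE.
rewrite /splice e !addE !mul_mx_pidE mul_mx_copidE mul_pid_mxE !mul_copid_mxE b.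
case: ltnP => ia; case: ltnP => ja; rewrite ?mulr0n ?mul0rn ?mulr1n ?addr0 ?add0r //.
Qed.

Lemma splice_lower Q X Z : lower_unitriangular X -> lower_unitriangular Z ->
  lower_unitriangular (splice Q X Z).
Proof.
move=> lX lZ i j ij; rewrite spliceE; case: ltnP => ia.
  rewrite lX //; case: ltnP => // ja; rewrite mulr0n -val_eqE ltn_eqF //.
  exact: leq_trans ia ja.
by rewrite (leq_trans ia ij) lZ.
Qed.

Definition chart_inv z := invmx (chart_mx z).

(** As [strict_mx z] is strictly lower triangular, this determines the inverse row
    by row. *)
Lemma chart_invE z i j :
  chart_inv z i j = (i == j)%:R - \sum_l strict_mx z i l * chart_inv z l j.
Proof.
have h : chart_inv z i j + (strict_mx z *m chart_inv z) i j = (i == j)%:R.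
  transitivity ((chart_mx z *m chart_inv z) i j).
    by rewrite /chart_mx mulmxDl mul1mx [RHS]mxE.
  by rewrite mulmxV ?chart_mx_unit // mxE.
by rewrite -h [(strict_mx z *m _) i j]mxE addrK.
Qed.

Lemma chart_inv_lower z : lower_unitriangular (chart_inv z).
Proof.
suff h m i j : (i < m)%N -> (i <= j)%N -> chart_inv z i j = (i == j)%:R.
  by move=> i j; apply: (h i.+1).
elim: m i => // m IH i; rewrite ltnS => im ij.
rewrite chart_invE big1 ?subr0 // => l _; have [il|li] := leqP i l.
  by rewrite strict_mx0 // mul0r.
rewrite IH ?(leq_trans li) // ?(leq_trans (ltnW li)) //.
by rewrite -val_eqE ltn_eqF ?mulr0 // (leq_trans li).
Qed.

Lemma homog_one : (1 : {mpoly K[N]}) \is 0.-homog.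
Proof. exact: dhomog1. Qed.

Lemma homog_var (k : 'I_N) : ('X_k : {mpoly K[N]}) \is 1.-homog.
Proof. by rewrite dhomogX /= mdeg1. Qed.

Lemma leading_strict_l i j : (j < i)%N ->
  leading 1 (fun x _ => strict_mx x i j) (fun x _ => strict_mx x i j).
Proof.
move=> ji; apply: leading_ext (leading_term (homog_var _) homog_one (addn0 1%N)) _ _ => x z;
  by rewrite (strict_mx_enum _ ji) mevalXU meval1 mulr1.
Qed.

Lemma leading_strict_r i j : (j < i)%N ->
  leading 1 (fun _ z => strict_mx z i j) (fun _ z => strict_mx z i j).
Proof.
move=> ji; apply: leading_ext (leading_term homog_one (homog_var _) (add0n 1%N)) _ _ => x z;
  by rewrite (strict_mx_enum _ ji) mevalXU meval1 mul1r.
Qed.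

Lemma leading_chart_inv i j : (j < i)%N ->
  leading 1 (fun _ z => chart_inv z i j) (fun _ z => - strict_mx z i j).
Proof.
suff h m (i' : 'I_n) : (i' < m)%N -> (j < i')%N ->
    leading 1 (fun _ z => chart_inv z i' j) (fun _ z => - strict_mx z i' j).
  exact: (h i.+1).
elim: m i' => // m IH i'; rewrite ltnS => im ji.
have term l : leading 1 (fun _ z => -1 * (strict_mx z i' l * chart_inv z l j))
    (fun _ z => -1 * (if l == j then strict_mx z i' j else 0)).
  apply: leading_scale; have [->|lj] := eqVneq l j.
    apply: leading_ext (leading_strict_r ji) _ _ => // x z.
    by rewrite chart_inv_lower // eqxx mulr1.
  have [il|li] := leqP i' l.
    by apply: leading_ext (leading0 _ _ _) _ _ => // x z; rewrite strict_mx0 ?mul0r.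
  have [jl|lj'] := ltnP j l.
    have := leading_mul (leading_strict_r li) (IH l (leq_trans li im) jl).
    by move/leading_weaken; apply.
  apply: leading_ext (leading0 _ _ _) _ _ => // x z.
  by rewrite chart_inv_lower // (negPf lj) mulr0.
have := leading_sum (r := index_enum 'I_n) (P := xpredT) (fun l _ _ => term l).
move/leading_ext; apply=> x z.
  by rewrite [RHS]chart_invE -val_eqE gtn_eqF // sub0r -mulr_sumr mulN1r.
rewrite -mulr_sumr mulN1r (bigD1 j) //= eqxx big1 ?addr0 // => l /negPf ->.
by [].
Qed.

(** The coordinates of the lower left block of a splice. They start in degree 2
    instead of 1. *)
Definition crossing (k : 'I_N) : bool :=
  ((val (enum_val k)).2 < a <= (val (enum_val k)).1)%N.

Lemma leading_splice Q k :
  leading (1 + crossing k)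
    (fun x z => coords (splice Q (chart_mx x) (chart_inv z)) k)
    (fun x z => coords (splice Q (strict_mx x) (- strict_mx z)) k).
Proof.
rewrite /crossing; case E : (val (enum_val k)) => [i j] /=.
have ji : (j < i)%N by have := valP (enum_val k); rewrite E.
have cE X : coords X k = X i j by rewrite /coords /chart_coord E.
have chartE x (r s : 'I_n) : (s < r)%N -> chart_mx x r s = strict_mx x r s.
  by move=> sr; rewrite mxE mxE -val_eqE gtn_eqF // add0r.
have oppE z (r s : 'I_n) : (- strict_mx z) r s = - strict_mx z r s by rewrite [LHS]mxE.
have [ia|ai] := ltnP i a.
  rewrite andbF addn0; have ja := ltn_trans ji ia.
  apply: leading_ext (leading_strict_l ji) _ _ => x z;
    by rewrite cE spliceE ia ja mulr1n ?chartE.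
have [ja|aj] := ltnP j a; last first.
  rewrite addn0; apply: leading_ext (leading_chart_inv ji) _ _ => x z;
    by rewrite cE spliceE ltnNge ai aj //= [RHS]mxE.
have h : leading (1 + 1) (fun x z => bridge Q (chart_mx x) (chart_inv z) i j)
    (fun x z => bridge Q (strict_mx x) (- strict_mx z) i j).
  apply: (leading_sum (r := index_enum 'I_n)
    (G := fun l x z => \sum_m (chart_inv z i l *+ (l < a)%N) * Q l m * (chart_mx x m j *+ (a <= m)%N))
    (G0 := fun l x z => \sum_m ((- strict_mx z) i l *+ (l < a)%N) * Q l m * (strict_mx x m j *+ (a <= m)%N))).
  move=> l _ _; apply: (leading_sum (r := index_enum 'I_n)
    (G := fun m x z => (chart_inv z i l *+ (l < a)%N) * Q l m * (chart_mx x m j *+ (a <= m)%N))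
    (G0 := fun m x z => ((- strict_mx z) i l *+ (l < a)%N) * Q l m * (strict_mx x m j *+ (a <= m)%N))).
  move=> m _ _; have [la|al] := ltnP l a; last first.
    by apply: leading_ext (leading0 _ _ _) _ _ => x z; rewrite !mulr0n !mul0r.
  have [ma|am] := leqP a m; last first.
    by apply: leading_ext (leading0 _ _ _) _ _ => x z; rewrite !mulr0n !mulr0.
  have li := leq_trans la ai; have jm := leq_trans ja ma.
  have := leading_mul (leading_scale (Q l m) (leading_chart_inv li)) (leading_strict_l jm).
  move/leading_ext; apply=> x z; rewrite !mulr1n ?chartE // [Q l m * _]mulrC //.
  by rewrite oppE.
apply: leading_ext h _ _ => x z; by rewrite cE spliceE ltnNge ai /= leqNgt ja.
Qed.

(** The generalized inverse reproduces the lower left block. *)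
Lemma splice_tangent v k :
  coords (splice (pinvmx (P' *m strict_mx v *m P)) (strict_mx v) (strict_mx v)) k = v k.
Proof.
set V := strict_mx v; set M := P' *m V *m P.
have e : splice (pinvmx M) V V = P *m V *m P + P' *m V *m P' + M.
  rewrite /splice; congr (_ + _).
  have -> : P' *m V *m P *m pinvmx M *m P' *m V *m P = M *m pinvmx M *m M.
    by rewrite /M !mulmxA.
  by rewrite mulmxKpV.
have : V (val (enum_val k)).1 (val (enum_val k)).2 = v k := strict_mx_pos v k.
rewrite /coords /chart_coord e; have := valP (enum_val k).
case: (val (enum_val k)) => i j /= ji.
have addE (A B : 'M[K]_n) : (A + B) i j = A i j + B i j by rewrite mxE.
rewrite !addE /M !mul_mx_pidE mul_mx_copidE mul_pid_mxE !mul_copid_mxE.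
move=> <-; case: ltnP => ia; case: ltnP => ja; rewrite ?mulr0n ?mul0rn ?mulr1n ?addr0 ?add0r //.
by have := leq_trans ji (ltnW (leq_trans ia ja)); rewrite ltnn.
Qed.

Lemma strict_mx_scale c x : strict_mx (fun k => c * x k) = c *: strict_mx x.
Proof.
apply/matrixP => i j; rewrite [RHS]mxE; have [ij|ji] := leqP i j.
  by rewrite !strict_mx0 // mulr0.
by rewrite !(strict_mx_enum _ ji).
Qed.

(** The coordinates are those of the conjugate of the matrix by a diagonal matrix
    with the entries 1 and [c], and conjugation preserves the ranks of corners. *)
Lemma in_schubert_torus w x c : c != 0 -> in_schubert w x ->
  in_schubert w (fun k => c ^+ crossing k * x k).
Proof.
move=> c0 wx i j lin ljn; apply: leq_trans (wx i j lin ljn); rewrite leq_add2r.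
pose D (t : K) : 'M[K]_n := P + t *: P'.
have DE t (r s : 'I_n) : D t r s = (r == s)%:R * (if (r < a)%N then 1 else t).
  rewrite /D mxE pid_mxE mxE copid_mxE; case: (r == s); case: ltnP => _ /=;
  by rewrite ?mulr0 ?mul0r ?mulr1 ?mul1r ?addr0 ?add0r.
have tD t : upper_triangular (D t).
  by move=> r s sr; rewrite DE -val_eqE gtn_eqF // mul0r.
have -> : chart_mx (fun k => c ^+ crossing k * x k) = D c *m chart_mx x *m D c^-1.
  apply/matrixP => r s.
  have -> : (D c *m chart_mx x *m D c^-1) r s
      = (if (r < a)%N then 1 else c) * chart_mx x r s * (if (s < a)%N then 1 else c^-1).
    rewrite mxE (bigD1 s) //= big1 ?addr0 => [|l ls].
      rewrite DE eqxx mul1r mxE (bigD1 r) //= big1 ?addr0 => [|l ls].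
        by rewrite DE eqxx mul1r.
      by rewrite DE eq_sym (negPf ls) !mul0r.
    by rewrite DE (negPf ls) mul0r mulr0.
  have [rs|sr] := leqP r s.
    rewrite !chart_mx_lower //; case: (eqVneq r s) => [->|_]; last by rewrite mulr0 mul0r.
    by case: ifP => _; rewrite mulr1 ?mulr1 // divff.
  rewrite !mxE -val_eqE gtn_eqF // !add0r !insubT /= /crossing enum_rankK /=.
  case: (ltnP r a) => ra; case: (ltnP s a) => sa /=; rewrite ?expr0 ?expr1 ?mul1r ?mulr1 //.
    by have := leq_trans sr (ltnW (leq_trans ra sa)); rewrite ltnn.
  by rewrite mulrC mulKf.
exact: rank_corner_le.
Qed.

(** The rank conditions before the cut come from [x]; those after the cut come
    from the inverse of the matrix of [z], which transposes them. *)
Lemma splice_in_schubert w w' Q x z : flip a w w' -> in_schubert w x -> in_schubert w z ->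
  in_schubert w' (coords (splice Q (chart_mx x) (chart_inv z))).
Proof.
move=> [_ cw' wl wr] wx wz; apply: in_schubert_pillars => p pw'.
have lin1 := ltnW (ltn_ord p.1); have lin2 := ltnW (ltn_ord p.2).
rewrite chart_mxK; last exact: splice_lower (chart_mx_lower x) (chart_inv_lower z).
case/orP: (cw' p pw') => /andP[h1 h2].
  rewrite wl //; apply: leq_trans (wx _ _ lin1 lin2).
  by rewrite leq_add2r splice_ll.
rewrite wr ?h1 ?h2 //.
have C := wz _ _ lin2 lin1; have B := rank_corner_inv (chart_mx_unit z) lin1 lin2.
rewrite -/(chart_inv z) in B.
have A := splice_rr Q (chart_mx x) (chart_inv z) h1 h2.
rewrite -(leq_add2r p.2); apply: (@leq_trans (\rank (corner p.1 p.2 (chart_inv z))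
  + rank_entry w p.2 p.1 + p.2)); first by rewrite !leq_add2r.
by rewrite addnAC B addnAC addnC leq_add2l.
Qed.

(** Apply [leading_cone] to [p] composed with the splice, at the tangent vectors
    [v] and [- v]. As the crossing coordinates start in degree 2, the number of them
    in a monomial of [p] adds to the order of the composition. By the torus action
    the part of [p] where this number is [g] vanishes on the variety as well, and for
    this part the shift of the order is the constant [g]. *)
Lemma cone_flip w w' v : flip a w w' ->
  cone (in_schubert w) v -> cone (in_schubert w') v.
Proof.
move=> f wv p d pw' low.
pose Q := pinvmx (P' *m strict_mx v *m P).
pose wt (m : 'X_{1..N}) := (\sum_k m k * crossing k)%N.
pose psi x z k := coords (splice Q (chart_mx x) (chart_inv z)) k.
pose psi0 x z k := coords (splice Q (strict_mx x) (- strict_mx z)) k.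
have graded g y : in_schubert w' y ->
    \sum_(m <- msupp p | wt m == g) p@_m * \prod_k y k ^+ m k = 0.
  move=> w'y.
  pose q : {poly K} := \sum_(m <- msupp p) (p@_m * \prod_k y k ^+ m k) *: 'X^(wt m).
  have q0 : q = 0.
    apply: horner_punctured => c c0; rewrite -(pw' _ (in_schubert_torus c0 w'y)).
    rewrite /q horner_sum mevalE; apply: eq_bigr => m _.
    rewrite hornerZ hornerXn -mulrA; congr (_ * _).
    rewrite /wt expr_sum -big_split /=; apply: eq_bigr => k _.
    by rewrite exprMn exprAC -exprM mulrC mulnC.
  rewrite -[RHS](_ : q`_g = 0); last by rewrite q0 coef0.
  rewrite /q coef_sum big_mkcond; apply: eq_bigr => m _.
  by rewrite coefZ coefXn eq_sym; case: eqP => _; rewrite ?mulr1 ?mulr0.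
have part g : \sum_(m <- msupp p | (wt m == g) && (mdeg m == d)) p@_m * \prod_k v k ^+ m k = 0.
  have lead : leading (d + g)
      (fun x z => \sum_(m <- msupp p | wt m == g) p@_m * \prod_k psi x z k ^+ m k)
      (fun x z => \sum_(m <- msupp p | wt m == g)
         (if mdeg m == d then p@_m * \prod_k psi0 x z k ^+ m k else 0)).
    apply: leading_sum => m mp /eqP mg.
    have h : leading (mdeg m + g) (fun x z => p@_m * \prod_k psi x z k ^+ m k)
        (fun x z => p@_m * \prod_k psi0 x z k ^+ m k).
      apply: leading_scale; rewrite -mg /wt mdegE -big_split /=.
      have := leading_prod (index_enum 'I_N) (fun k => leading_exp (m k) (leading_splice Q k)).
      move/leading_ext => /(_ _ _ (fun _ _ => erefl) (fun _ _ => erefl)).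
      congr (leading _ _ _); apply: eq_bigr => k _.
      by case: (crossing k); lia.
    have [e|ne] := eqVneq (mdeg m) d; first by rewrite -e.
    apply: leading_weaken h _; rewrite ltn_add2r ltn_neqAle eq_sym ne.
    exact: msupp_low low mp.
  have wNv := cone_scale (-1) wv.
  have vanish x z : in_schubert w x -> in_schubert w z ->
      \sum_(m <- msupp p | wt m == g) p@_m * \prod_k psi x z k ^+ m k = 0.
    by move=> wx wz; apply: graded; exact: splice_in_schubert f wx wz.
  rewrite big_mkcondr -[RHS](leading_cone wv wNv lead vanish).
  apply: eq_bigr => m _; case: eqP => // _.
  congr (_ * _); apply: eq_bigr => k _.
  by rewrite /psi0 strict_mx_scale scaleN1r opprK splice_tangent.
rewrite pihomog_meval; pose B := (\max_(m <- msupp p) wt m).+1.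
transitivity (\sum_(g < B) \sum_(m <- msupp p | (wt m == g) && (mdeg m == d))
    p@_m * \prod_k v k ^+ m k); last by rewrite big1.
under [RHS]eq_bigr => g _ do rewrite big_mkcondl.
rewrite exchange_big /= big_seq_cond [RHS]big_seq_cond; apply: eq_bigr => m /andP[mp _].
have mB : (wt m < B)%N by rewrite ltnS; apply: leq_bigmax_seq.
rewrite [RHS](bigD1 (Ordinal mB)) //= eqxx [X in _ = _ + X]big1 ?addr0 // => g gm.
by rewrite -val_eqE /= eq_sym in gm; rewrite (negPf gm).
Qed.

End FlipCone.

(** * Partial transpositions *)

Theorem theorem3p6 (R : realType) (n : nat) (w : 'S_n) :
  (forall L : {set 'I_n * 'I_n}, union_of_link_classes R w L ->
     exists w' : 'S_n, partial_transposition L w w')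
  /\
  (forall w' : 'S_n, admissibly_partially_transpose R w w' ->
     forall v : lower_pos n -> complex R,
       tangent_cone w v <-> tangent_cone w' v).
Proof.
pose same_cone (u1 u2 : 'S_n) := forall v : lower_pos n -> complex R,
  tangent_cone u1 v <-> tangent_cone u2 v.
have flips L : union_of_link_classes R w L ->
    exists2 u, partial_transposition L w u & same_cone w u.
  move=> unionL; apply: (flip_sequence unionL (Q := same_cone)).
  - by [].
  - by move=> u1 u2 u3 h12 h23 v; rewrite (h12 v).
  - move=> a u1 u2 an f v; rewrite !tangent_coneP.
    by split; apply: cone_flip; [exact: f|exact: flip_sym f].
split=> [L /flips[u]|w' [L /flips[u wu wuT] ww']]; first by exists u.
by rewrite (partial_transposition_unique ww' wu).
Qed.
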